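(* Consider the directed Chung--Lu model with adjacency matrix $A_n$, and let $T_n=D_n^{-1}A_n$ with $D_n^{-1}$ as in the context. If the rank-one weight profile assumption (W) and the growth assumption (X) (stated in the context) hold, then there exist $K>0$ and $\eta>1$ such that, for all sufficiently large $n$, $$\mathbb{P}\left(\max_{2\le j\le n}|\lambda_j(T_n)|\ge\frac{K}{\sqrt{s_n}}\right)\le e^{-(\log n)^\eta}.$$
   Context: Model. For every $n$ let $(w_x^+,w_x^-)_{x\in[n]}$ be deterministic non-negative weights (depending on $n$) with $\sum_{x=1}^n w_x^+=\sum_{x=1}^n w_x^-=:\mathbf{w}_n$. The matrix $A_n=(a_{xy})_{x,y\in[n]}$ has independent Bernoulli entries with $p_{xy}:=\mathbb{P}(a_{xy}=1)=s_n w_x^+w_y^-/\mathbf{w}_n$, where $s_n>0$; under the assumptions below $p_{xy}<1$ for large $n$. (W) There exist constants $0<c<C<\infty$ with $c\le w_x^\pm\le C$ for all $x\in[n]$, $n\ge1$; moreover there is a compactly supported probability measure $\rho$ on $(0,\infty)^2$ such that $\frac1n\sum_{x=1}^n\delta_{\sqrt{n/\mathbf{w}_n}\,(w_x^+,w_x^-)}$ converges weakly to $\rho$. (X) There exists $\xi>4$ such that $\log^\xi(n)\ll s_n\ll n$, where $a_n\ll b_n$ means $a_n/b_n\to0$. $D_x^+=\sum_{y\in[n]}a_{xy}$ is the out-degree of $x$, and $D_n^{-1}$ is the diagonal matrix with entries $D_n^{-1}(x,x)=1/D_x^+$ if $D_x^+>0$ and $D_n^{-1}(x,x)=0$ otherwise.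 Eigenvalues of an $n\times n$ complex matrix $M$ are ordered so that $|\lambda_1(M)|\ge\dots\ge|\lambda_n(M)|$. *)

(* Defs.v *)
From HB Require Import structures.
From mathcomp Require Import all_boot all_order all_algebra.
From mathcomp Require Import all_classical all_reals all_analysis.
From mathcomp Require Import complex.

Set Implicit Arguments.
Unset Strict Implicit.
Unset Printing Implicit Defensive.
Import Order.TTheory GRing.Theory Num.Theory.
Import numFieldNormedType.Exports.
Local Open Scope classical_set_scope.
Local Open Scope ring_scope.

Section asymptotics.
Variable R : realType.

Definition negligible_wrt (a b : nat -> R) : Prop :=
  (fun n => a n / b n) @ \oo --> (0 : R).

End asymptotics.

Section eigenvalues.
Variable R : realType.

Definition cmod (z : R[i]) : R := ComplexField.Normc.normc z.

(* The roots of the characteristic polynomial, listed with algebraic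
   multiplicity and by non-increasing modulus. *)
Definition eigenvalues n (M : 'M[R[i]]_n) : seq R[i] :=
  sort (fun z w => cmod w <= cmod z)
    (sval (closed_field_poly_normal (char_poly M))).

(* 1-based, as in |lambda_1| >= ... >= |lambda_n|. *)
Definition lambda n (M : 'M[R[i]]_n) (j : nat) : R[i] :=
  nth 0 (eigenvalues M) j.-1.

(* All moduli are nonnegative, so the default value 0 only matters when the
   range is empty (n <= 1). *)
Definition max_nontrivial_modulus n (M : 'M[R[i]]_n) : R :=
  \big[Num.max/0]_(2 <= j < n.+1) cmod (lambda M j).

End eigenvalues.

Section random_walk_matrix.
Variable R : realType.

Definition adjacency_matrix n (b : 'I_n * 'I_n -> bool) : 'M[R]_n :=
  \matrix_(x, y) (b (x, y))%:R.

Definition out_degree n (A : 'M[R]_n) (x : 'I_n) : R := \sum_y A x y.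

Definition inv_degree_matrix n (A : 'M[R]_n) : 'M[R]_n :=
  diag_mx (\row_x (if 0 < out_degree A x then (out_degree A x)^-1 else 0)).

Definition transition_matrix n (A : 'M[R]_n) : 'M[R]_n :=
  inv_degree_matrix A *m A.

Definition complexify n (A : 'M[R]_n) : 'M[R[i]]_n :=
  map_mx (real_complex R) A.

End random_walk_matrix.

Section independence.
Context d d' (T : measurableType d) (T' : measurableType d') (R : realType).
Variable P : probability T R.

Definition mutually_independent (I : finType) (X : I -> {mfun T >-> T'}) :
    Prop :=
  forall (J : {set I}) (B : I -> set T'),
    (forall i, measurable (B i)) ->
    (P (\bigcap_(i in [set` J]) (X i @^-1` B i))
     = \prod_(i in J) P (X i @^-1` B i))%E.

End independence.

Section model.
Context d (T : measurableType d) (R : realType).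
Variable P : probability T R.

Definition directed_chung_lu n (wp wm : 'I_n -> R) (s : R)
    (a : 'I_n * 'I_n -> {mfun T >-> bool}) : Prop :=
  mutually_independent P a /\
  (forall x y : 'I_n,
     P (a (x, y) @^-1` [set true])
     = (s * wp x * wm y / \sum_(z < n) wp z)%:E).

End model.

Section empirical.
Context d (T : measurableType d) (R : realType).

Definition empirical n (u : 'I_n -> T) (A : set T) : \bar R :=
  ((n%:R^-1)%:E * \sum_(i < n) \d_(u i) A)%E.

Section empirical_measure.
Variables (n : nat) (u : 'I_n -> T).

Let diracs (k : nat) : {measure set T -> \bar R} :=
  if insub k is Some i then \d_(u i) : {measure set T -> \bar R} else mzero.

Let inv_ge0 : 0 <= n%:R^-1 :> R. Proof. by rewrite invr_ge0 ler0n. Qed.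

Let empiricalE : empirical u = mscale (NngNum inv_ge0) (msum diracs n).
Proof.
apply/funext => A; rewrite /empirical /mscale /msum /=; congr (_ * _)%E.
by apply: eq_bigr => i _; rewrite /diracs valK.
Qed.

Let empirical0 : empirical u set0 = 0%E.
Proof. by rewrite empiricalE measure0. Qed.

Let empirical_ge0 A : (0 <= empirical u A)%E.
Proof. by rewrite empiricalE measure_ge0. Qed.

Let empirical_sigma_additive : semi_sigma_additive (empirical u).
Proof. by rewrite empiricalE; exact: measure_semi_sigma_additive. Qed.

HB.instance Definition _ := isMeasure.Build _ _ _ (empirical u)
  empirical0 empirical_ge0 empirical_sigma_additive.

End empirical_measure.
End empirical.
Arguments empirical {d T R n} u A.

Section plane.
Variable R : realType.

Local Notation plane := (measurableTypeR R * measurableTypeR R)%type.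

Definition weakly_converges (mu : nat -> {measure set plane -> \bar R})
    (rho : {measure set plane -> \bar R}) : Prop :=
  forall f : R * R -> R, continuous f ->
    (exists M : R, forall z, `|f z| <= M) ->
    (\int[mu n]_z (f z)%:E)%E @[n --> \oo] --> (\int[rho]_z (f z)%:E)%E.

Definition compactly_supported_in (D : set (R * R))
    (rho : {measure set plane -> \bar R}) : Prop :=
  exists K : set (R * R), [/\ compact K, K `<=` D & rho (~` K) = 0%E].

Definition open_quadrant : set (R * R) := [set z | 0 < z.1 /\ 0 < z.2].

Definition normalized_weights n (wp wm : 'I_n -> R) (x : 'I_n) : plane :=
  let r := Num.sqrt (n%:R / \sum_(z < n) wp z) in (r * wp x, r * wm x).

Definition weight_profile (wp wm : forall n, 'I_n -> R) : Prop :=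
  (exists c C : R, [/\ 0 < c, c < C &
     forall n (x : 'I_n), c <= wp n x <= C /\ c <= wm n x <= C]) /\
  (exists rho : probability plane R,
     compactly_supported_in open_quadrant rho /\
     weakly_converges (fun n => empirical (normalized_weights (wp n) (wm n)))
                      rho).

Definition sparsity_growth (s : nat -> R) : Prop :=
  exists xi : R, [/\ 4 < xi,
    negligible_wrt (fun n => ln n%:R `^ xi) s &
    negligible_wrt s (fun n => n%:R)].

End plane.

(* Main.v *)
(* Write [v_y = w^-_y / W], [u_x = s w^+_x] and [M = A - u v = A - E A].  As [T 1 = 1] and
   [v 1 = 1], deflating [T] by [1 v] replaces one eigenvalue [1] by [0], and
   [T - 1 v = D^-1 M (1 - 1 v)]; so [|lambda_2(T)|] is at most [max_x (1 / D_x) ||M||] up to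
   a constant, and one needs [D_x >= c s] (a Chernoff bound) and [||M|| = O(sqrt s)].

   The latter is the trace method with [E tr (M M^T)^k], [k] of order [s].  Only closed
   walks using every edge at least twice contribute; grouped by shape, their total weight
   is dominated by that of a dense [4k x 4k] matrix [Y] with centred Bernoulli(1/3)
   entries, all of whose moments of order at least two are positive.  [||Y|| = O(sqrt k)]
   follows from a subgaussian bound over a lattice net of the ball. *)

Require Import Defs.
From HB Require Import structures.
From mathcomp Require Import all_boot all_order all_algebra.
From mathcomp Require Import all_classical all_reals all_analysis.
From mathcomp Require Import complex.
From mathcomp Require Import ring lra zify.
Set Implicit Arguments.
Unset Strict Implicit.
Unset Printing Implicit Defensive.
Import Order.TTheory GRing.Theory Num.Theory.
Import numFieldNormedType.Exports.
Local Open Scope ring_scope.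

(** * Frobenius norm and operator bounds *)

Section frobenius.
Variable R : realFieldType.

(** The centred sparse entries have nonzero odd moments, so walks using some edge three or five
    times contribute. A comparison matrix with symmetric entries, Rademacher or Gaussian, gives such
    walks weight zero and cannot dominate them. Bernoulli(1/3) is skewed enough that its central
    moment of order [m] is at least [3 ^- m] for every [m >= 2], and bounded, hence subgaussian.

    The comparison is not free: a walk with E distinct edges may visit E + 1 vertices, and this one
    extra vertex costs a factor [q^-1], where [q], of order s / n, bounds all link probabilities.
    Taking [k] of order s repays it: Markov's inequality for a [k]-th moment, with a large enough
    constant in the norm bound, leaves a tail [exp (- 2 k)], which beats any power of n because s
    dominates (log n)^2. The Chernoff bounds for the n rows have the same exponential scale, so a
    union bound suffices.

    The dependence between D and [M] is harmless, since [D^-1] and [M] are bounded separately on a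
    good event and the rest is deterministic. *)

Definition sqn m n (A : 'M[R]_(m, n)) : R := \sum_i \sum_j A i j ^+ 2.

Lemma sqn_ge0 m n (A : 'M[R]_(m, n)) : 0 <= sqn A.
Proof. by apply: sumr_ge0 => i _; apply: sumr_ge0 => j _; exact: sqr_ge0. Qed.

Lemma sqnE m n (A : 'M[R]_(m, n)) : sqn A = \tr (A *m A^T).
Proof.
rewrite /sqn /mxtrace; apply: eq_bigr => i _; rewrite mxE.
by apply: eq_bigr => j _; rewrite mxE expr2.
Qed.

Lemma sqn_tr m n (A : 'M[R]_(m, n)) : sqn A^T = sqn A.
Proof. by rewrite !sqnE trmxK mxtrace_mulC. Qed.

Lemma sqnZ m n (a : R) (A : 'M[R]_(m, n)) : sqn (a *: A) = a ^+ 2 * sqn A.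
Proof.
rewrite /sqn mulr_sumr; apply: eq_bigr => i _; rewrite mulr_sumr.
by apply: eq_bigr => j _; rewrite mxE exprMn.
Qed.

Lemma sqn_entry m n (A : 'M[R]_(m, n)) i j : A i j ^+ 2 <= sqn A.
Proof.
rewrite /sqn (bigD1 i) //= (bigD1 j) //= -addrA lerDl addr_ge0 //.
  by apply: sumr_ge0 => ? _; exact: sqr_ge0.
by apply: sumr_ge0 => ? _; apply: sumr_ge0 => ? _; exact: sqr_ge0.
Qed.

Lemma sqn_eq0 m n (A : 'M[R]_(m, n)) : sqn A = 0 -> A = 0.
Proof.
move=> A0; apply/matrixP => i j; rewrite mxE; apply/eqP.
by rewrite -sqrf_eq0 eq_le sqr_ge0 -A0 sqn_entry.
Qed.

Lemma sqn11 (A : 'M[R]_1) : sqn A = A 0 0 ^+ 2.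
Proof. by rewrite /sqn !big_ord1. Qed.

Lemma sqnD_le m n (A B : 'M[R]_(m, n)) : sqn (A + B) <= 2 * (sqn A + sqn B).
Proof.
rewrite /sqn -big_split mulr_sumr ler_sum //= => i _.
rewrite -big_split mulr_sumr ler_sum //= => j _; rewrite mxE.
have := sqr_ge0 (A i j - B i j); lra.
Qed.

Lemma cauchy_schwarz_sum (I : finType) (a b : I -> R) :
  (\sum_i a i * b i) ^+ 2 <= (\sum_i a i ^+ 2) * (\sum_i b i ^+ 2).
Proof.
have H : 0 <= \sum_i \sum_j (a i * b j - a j * b i) ^+ 2.
  by apply: sumr_ge0 => i _; apply: sumr_ge0 => j _; exact: sqr_ge0.
suff E : \sum_i \sum_j (a i * b j - a j * b i) ^+ 2 =
  2 * ((\sum_i a i ^+ 2) * (\sum_i b i ^+ 2) - (\sum_i a i * b i) ^+ 2).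
  by move: H; rewrite E pmulr_rge0 // subr_ge0.
have -> : \sum_i \sum_j (a i * b j - a j * b i) ^+ 2 =
  \sum_i \sum_j (a i ^+ 2 * b j ^+ 2 + b i ^+ 2 * a j ^+ 2 +
                 (a i * b i) * (- 2 * (a j * b j))).
  by apply: eq_bigr => i _; apply: eq_bigr => j _; ring.
under eq_bigr do rewrite !big_split /= -!mulr_sumr.
rewrite !big_split /= -!mulr_suml; ring.
Qed.

Lemma sqn_mul m n p (A : 'M[R]_(m, n)) (B : 'M[R]_(n, p)) :
  sqn (A *m B) <= sqn A * sqn B.
Proof.
rewrite -(sqn_tr B) /sqn mulr_suml ler_sum // => i _.
rewrite mulr_sumr ler_sum // => j _; rewrite mxE.
apply: le_trans (cauchy_schwarz_sum _ _) _.
by rewrite ler_wpM2l ?sumr_ge0 // => [? _|]; rewrite ?sqr_ge0 // ler_sum // => k _; rewrite mxE.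
Qed.

(* The operator norm of [A] is at most [Num.sqrt c]. *)
Definition opb m n (c : R) (A : 'M[R]_(m, n)) : Prop :=
  forall v : 'cV_n, sqn (A *m v) <= c * sqn v.

Lemma opb_mul m n p c d (A : 'M[R]_(m, n)) (B : 'M[R]_(n, p)) :
  0 <= c -> opb c A -> opb d B -> opb (c * d) (A *m B).
Proof.
move=> c0 cA dB v; rewrite -mulmxA; apply: le_trans (cA _) _.
by rewrite -mulrA ler_wpM2l.
Qed.

(** With [w = A^T v], Cauchy-Schwarz bounds [sqn w ^ 2 = <v, A w> ^ 2] by [sqn v * (c * sqn w)]; one
    factor [sqn w] cancels. *)
Lemma opb_tr m n c (A : 'M[R]_(m, n)) : 0 <= c -> opb c A -> opb c A^T.
Proof.
move=> c0 cA v; set w := A^T *m v.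
have [->|w0] := eqVneq (sqn w) 0; first by rewrite mulr_ge0 // sqn_ge0.
have wp : 0 < sqn w by rewrite lt_def w0 sqn_ge0.
rewrite -(ler_pM2r wp).
have -> : sqn w * sqn w = sqn (v^T *m (A *m w)).
  rewrite mulmxA sqn11 -expr2; congr (_ ^+ 2).
  have -> : v^T *m A = w^T by rewrite trmx_mul trmxK.
  by rewrite -(sqn_tr w) sqnE trmxK /mxtrace big_ord1.
apply: le_trans (sqn_mul _ _) _; rewrite sqn_tr mulrC -mulrA [_ * sqn w]mulrC mulrA.
by rewrite ler_wpM2r ?sqn_ge0.
Qed.

Lemma opb_exp n c (A : 'M[R]_n) k : 0 <= c -> opb c A -> opb (c ^+ k) (A ^+ k).
Proof.
move=> c0 cA; elim: k => [|k IH] v; first by rewrite !expr0 mul1r mul1mx.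
by rewrite exprS exprS; apply: opb_mul.
Qed.

Lemma tr_exp_le n c (A : 'M[R]_n) k : 0 <= c -> opb c A ->
  \tr ((A *m A^T) ^+ k) <= n%:R * c ^+ k.
Proof.
move=> c0 cA.
rewrite /mxtrace; apply: (@le_trans _ _ (\sum_(i < n) c ^+ k)); last first.
  by rewrite sumr_const card_ord -[X in X <= _]mulr_natl lexx.
apply: ler_sum => i _; set S := (A *m A^T) ^+ k.
have H : opb ((c * c) ^+ k) S.
  by apply: opb_exp; rewrite ?mulr_ge0 //; apply: opb_mul => //; exact: opb_tr.
apply: le_trans (ler_norm _) _.
rewrite -(@ler_sqr _ `|_|) ?nnegrE ?exprn_ge0 // real_normK ?num_real //.
have := H (delta_mx i 0); rewrite -colE.
have -> : sqn (delta_mx i 0 : 'cV[R]_n) = 1.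
  rewrite /sqn (bigD1 i) //= big_ord1 mxE !eqxx expr1n big1 ?addr0 // => j ji.
  by rewrite big_ord1 mxE (negbTE ji) expr0n.
rewrite mulr1 -expr2 exprAC => /(le_trans _); apply.
by have := sqn_entry (col i S) i 0; rewrite mxE.
Qed.

Lemma quad_sq_le n (S : 'M[R]_n) (v : 'cV[R]_n) : S^T = S ->
  sqn (S *m v) ^+ 2 <= sqn v * sqn (S *m S *m v).
Proof.
move=> SS; have -> : sqn (S *m v) ^+ 2 = sqn (v^T *m (S *m S *m v)).
  rewrite sqn11; congr (_ ^+ 2).
  by rewrite -sqn_tr sqnE trmxK trmx_mul SS /mxtrace big_ord1 !mulmxA.
by apply: le_trans (sqn_mul _ _) _; rewrite sqn_tr.
Qed.

Lemma trmx_exp n (S : 'M[R]_n) k : S^T = S -> (S ^+ k)^T = S ^+ k.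
Proof.
move=> SS; elim: k => [|k IH]; first by rewrite expr0 trmx1.
by rewrite exprS trmx_mul SS IH -[RHS]exprS exprSr.
Qed.

(* Repeated squaring of Cauchy-Schwarz replaces diagonalisation. *)
Lemma sym_norm_pow2 n (S : 'M[R]_n) (v : 'cV[R]_n) j : S^T = S ->
  sqn (S *m v) ^+ (2 ^ j) <= sqn v ^+ (2 ^ j - 1) * sqn (S ^+ (2 ^ j) *m v).
Proof.
elim: j S => [|j IH] S SS; first by rewrite expn0 subnn expr0 mul1r !expr1.
have SS2 : (S *m S)^T = S *m S by rewrite trmx_mul SS.
have E : (2 ^ j.+1 - 1 = 2 ^ j + (2 ^ j - 1))%N.
  by rewrite expnS mul2n -addnn addnBA // expn_gt0.
rewrite E exprD expnS [X in _ <= _ * sqn (X *m _)]exprM exprM -mulrA.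
apply: (@le_trans _ _ ((sqn v * sqn (S *m S *m v)) ^+ (2 ^ j))).
  by rewrite lerXn2r ?nnegrE ?mulr_ge0 ?exprn_ge0 ?sqn_ge0 // quad_sq_le.
by rewrite exprMn ler_wpM2l ?exprn_ge0 ?sqn_ge0 // expr2 IH.
Qed.

(** One Cauchy-Schwarz step passes from [A^T] to the symmetric [S = A A^T], repeated squaring passes
    to [S ^+ K], and the Frobenius norm bounds the latter: its square is the trace of
    [S ^+ (2 K)]. *)
Lemma sqn_le_trace m n (A : 'M[R]_(m, n)) (v : 'cV[R]_m) j :
  sqn (A^T *m v) ^+ (2 ^ j.+1) <=
  \tr ((A *m A^T) ^+ (2 ^ j.+1)) * sqn v ^+ (2 ^ j.+1).
Proof.
set S := A *m A^T; set K := (2 ^ j)%N.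
have SS : S^T = S by rewrite /S trmx_mul trmxK.
have H1 : sqn (A^T *m v) ^+ 2 <= sqn v * sqn (S *m v).
  have -> : sqn (A^T *m v) ^+ 2 = sqn (v^T *m (S *m v)).
    rewrite sqn11; congr (_ ^+ 2).
    by rewrite -sqn_tr sqnE trmxK trmx_mul trmxK /mxtrace big_ord1 !mulmxA.
  by apply: le_trans (sqn_mul _ _) _; rewrite sqn_tr.
have H2 : \tr (S ^+ (2 ^ j.+1)) = sqn (S ^+ K).
  by rewrite sqnE trmx_exp // expnS mulnC exprM expr2.
rewrite H2 expnS !exprM -/K.
apply: (@le_trans _ _ ((sqn v * sqn (S *m v)) ^+ K)).
  by rewrite lerXn2r ?nnegrE ?mulr_ge0 ?exprn_ge0 ?sqn_ge0.
rewrite exprMn mulrC.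
apply: (@le_trans _ _ ((sqn v ^+ (K - 1) * sqn (S ^+ K *m v)) * sqn v ^+ K)).
  by rewrite ler_wpM2r ?exprn_ge0 ?sqn_ge0 // sym_norm_pow2.
rewrite [_ ^+ 2 ^+ K]exprAC expr2 mulrA ler_wpM2r ?exprn_ge0 ?sqn_ge0 //.
have -> : sqn v ^+ K = sqn v ^+ (K - 1) * sqn v.
  by rewrite -exprSr subn1 prednK // expn_gt0.
rewrite mulrCA ler_wpM2l ?exprn_ge0 ?sqn_ge0 //; exact: sqn_mul.
Qed.

Lemma opb_of_trace m n (A : 'M[R]_(m, n)) c j : 0 <= c ->
  \tr ((A *m A^T) ^+ (2 ^ j.+1)) <= c ^+ (2 ^ j.+1) -> opb c A.
Proof.
move=> c0 H; rewrite -(trmxK A); apply: opb_tr => // v.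
have k0 : (0 < 2 ^ j.+1)%N by rewrite expn_gt0.
rewrite -(@ler_pXn2r _ (2 ^ j.+1)) ?nnegrE ?mulr_ge0 ?sqn_ge0 //.
apply: le_trans (sqn_le_trace _ _ _) _.
by rewrite exprMn ler_wpM2r ?exprn_ge0 ?sqn_ge0.
Qed.

End frobenius.

(** * Product Bernoulli expectations *)

Section bernoulli.
Variables (R : realFieldType) (I : finType).

Definition bmass (p : I -> R) (b : {ffun I -> bool}) : R :=
  \prod_i (if b i then p i else 1 - p i).

(** Expectations are finite sums over configurations, which keeps measure theory out of the moment
    method; [chung_lu_law] transfers the outcome to the probability space. *)
Definition Ebern (p : I -> R) (f : {ffun I -> bool} -> R) : R :=
  \sum_b bmass p b * f b.

Lemma Ebern_prod p (F : I -> bool -> R) :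
  Ebern p (fun b => \prod_i F i (b i)) =
  \prod_i (p i * F i true + (1 - p i) * F i false).
Proof.
rewrite /Ebern /bmass.
transitivity (\sum_(b : {ffun I -> bool})
    \prod_i ((if b i then p i else 1 - p i) * F i (b i))).
  by apply: eq_bigr => b _; rewrite [RHS]big_split.
rewrite -(bigA_distr_bigA (fun i (v : bool) => (if v then p i else 1 - p i) * F i v)).
by apply: eq_bigr => i _; rewrite big_bool.
Qed.

Lemma Ebern_sum p (J : Type) (r : seq J) (Q : pred J) (f : J -> {ffun I -> bool} -> R) :
  Ebern p (fun b => \sum_(j <- r | Q j) f j b) = \sum_(j <- r | Q j) Ebern p (f j).
Proof.
rewrite /Ebern exchange_big; apply: eq_bigr => b _; rewrite mulr_sumr.
by apply: eq_bigr.
Qed.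

Lemma EbernZ p a f : Ebern p (fun b => a * f b) = a * Ebern p f.
Proof. by rewrite /Ebern mulr_sumr; apply: eq_bigr => b _; rewrite mulrCA. Qed.

Lemma EbernD p f g : Ebern p (fun b => f b + g b) = Ebern p f + Ebern p g.
Proof. by rewrite /Ebern -big_split; apply: eq_bigr => b _; rewrite mulrDr. Qed.

Section nonneg.
Variable p : I -> R.
Hypothesis p01 : forall i, 0 <= p i <= 1.

Lemma bmass_ge0 b : 0 <= bmass p b.
Proof.
apply: prodr_ge0 => i _; have /andP[p0 p1] := p01 i.
by case: (b i); rewrite ?subr_ge0.
Qed.

Lemma Ebern_le f g : (forall b, f b <= g b) -> Ebern p f <= Ebern p g.
Proof. by move=> fg; apply: ler_sum => b _; rewrite ler_wpM2l ?bmass_ge0. Qed.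

Lemma Ebern_markov (Q : pred {ffun I -> bool}) f c : 0 < c ->
  (forall b, 0 <= f b) -> (forall b, Q b -> c <= f b) ->
  Ebern p (fun b => (Q b)%:R) <= Ebern p f / c.
Proof.
move=> c0 f0 Qf; rewrite ler_pdivlMr // mulrC -EbernZ; apply: Ebern_le => b.
by have := Qf b; have := f0 b; case: (Q b) => /= *; rewrite ?mulr1 ?mulr0 //; auto.
Qed.

End nonneg.

(** The central moment of order [m] of a Bernoulli([q]) variable. *)
Definition cmoment (q : R) (m : nat) : R := q * (1 - q) ^+ m + (1 - q) * (- q) ^+ m.

Lemma cmoment0 q : cmoment q 0 = 1.
Proof. by rewrite /cmoment !expr0; ring. Qed.

Lemma cmoment1 q : cmoment q 1 = 0.
Proof. by rewrite /cmoment !expr1; ring. Qed.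

Lemma cmoment_abs_le q m : 0 <= q <= 1 -> `|cmoment q m.+2| <= q.
Proof.
move=> /andP[q0 q1]; have q1' : 0 <= 1 - q by rewrite subr_ge0.
apply: le_trans (ler_normD _ _) _.
rewrite [X in X + _]normrM [X in _ + X]normrM !normrX normrN (ger0_norm q0) (ger0_norm q1').
have -> : q * (1 - q) ^+ m.+2 + (1 - q) * q ^+ m.+2 =
  q * ((1 - q) * ((1 - q) ^+ m.+1 + q ^+ m.+1)) by rewrite !exprS; ring.
rewrite ler_piMr //.
have a1 : (1 - q) ^+ m.+1 <= 1 - q.
  by rewrite exprS ler_piMr // exprn_ile1 // lerBlDr lerDl.
have a2 : q ^+ m.+1 <= q by rewrite exprS ler_piMr // exprn_ile1.
apply: (@le_trans _ _ (1 - q)); last by rewrite lerBlDr lerDl.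
by rewrite ler_piMr //; lra.
Qed.

(** The centred variable is 2/3 with probability 1/3 and -1/3 otherwise, so the moment is
    [3 ^- m * (2 ^ m + 2 (-1) ^ m) / 3]. The last fraction vanishes at [m = 1] only and is at least
    1 elsewhere. *)
Lemma cmoment_third_ge m : m != 1%N -> 3 ^- m <= cmoment 3^-1 m.
Proof.
case: m => [|[|m]] // _; first by rewrite cmoment0 expr0 invr1.
have -> : cmoment 3^-1 m.+2 = 3 ^- m.+2 * ((2 ^+ m.+2 + 2 * (- 1) ^+ m.+2) / 3).
  rewrite /cmoment; have -> : 1 - 3^-1 = 2 * 3^-1 :> R by field.
  rewrite -[- 3^-1]mulN1r !exprMn -exprVn.
  move: (2 ^+ m.+2) ((- 1) ^+ m.+2) (3^-1 ^+ m.+2) => x y z; by field.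
rewrite ler_peMr ?invr_ge0 ?exprn_ge0 ?ler0n //.
rewrite ler_pdivlMr ?ltr0n // mul1r.
case: m => [|m]; first by rewrite !expr2; lra.
have h : -1 <= (- 1) ^+ m.+3 :> R.
  by rewrite -signr_odd; case: odd; rewrite ?expr0 ?expr1; lra.
have h2 : 8 <= 2 ^+ m.+3 :> R.
  have : 1 <= 2 ^+ m :> R by rewrite exprn_ege1 // ler1n.
  rewrite !exprS; lra.
lra.
Qed.

Lemma cmoment_third_ge0 m : 0 <= cmoment 3^-1 m.
Proof.
have [->|m1] := eqVneq m 1%N; first by rewrite cmoment1.
apply: le_trans (cmoment_third_ge m1).
by rewrite invr_ge0 exprn_ge0 // ler0n.
Qed.

Lemma Ebern_positions p (T : finType) (e : T -> I) :
  Ebern p (fun b => \prod_t ((b (e t))%:R - p (e t))) =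
  \prod_i cmoment (p i) #|[pred t | e t == i]|.
Proof.
have H (b : {ffun I -> bool}) : \prod_t ((b (e t))%:R - p (e t)) =
    \prod_i ((b i)%:R - p i) ^+ #|[pred t | e t == i]|.
  rewrite (partition_big e xpredT) //=; apply: eq_bigr => i _.
  rewrite -prodr_const; apply: eq_big => // t /eqP -> //.
under [Ebern p _]eq_bigr do rewrite H.
rewrite [LHS](Ebern_prod p (fun i v => (v%:R - p i) ^+ #|[pred t | e t == i]|)).
by apply: eq_bigr => i _; rewrite /cmoment /= sub0r.
Qed.

Definition repeated (T : finType) (e : T -> I) : bool :=
  [forall t, exists t', (t' != t) && (e t' == e t)].

Lemma repeatedPn (T : finType) (e : T -> I) :
  ~~ repeated e -> exists i, #|[pred t | e t == i]| = 1%N.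
Proof.
rewrite negb_forall => /existsP[t]; rewrite negb_exists => /forallP H.
exists (e t); apply/eqP; apply/card1P; exists t => t'; rewrite !inE.
have := H t'; rewrite negb_and negbK.
by case: eqVneq => [->|_] /=; [rewrite eqxx | move/negbTE].
Qed.

Lemma repeated_card (T : finType) (e : T -> I) i : repeated e ->
  #|[pred t | e t == i]| != 1%N.
Proof.
move=> /forallP rep; apply/negP => /card1P[t H].
have := H t; rewrite !inE eqxx => /eqP et.
have /existsP[t' /andP[t't]] := rep t; rewrite et => et'.
by have := H t'; rewrite !inE et' (negbTE t't).
Qed.

(** The expectation factors over distinct edges. An edge used once gives the factor 0; an edge used
    at least twice gives at most [q], whatever its multiplicity. *)
Lemma Ebern_positions_le p q (T : finType) (e : T -> I) :
  (forall i, 0 <= p i <= q) -> q <= 1 ->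
  `|Ebern p (fun b => \prod_t ((b (e t))%:R - p (e t)))| <=
  (repeated e)%:R * q ^+ #|codom e|.
Proof.
move=> pq q1; rewrite Ebern_positions.
case: (boolP (repeated e)) => [rep|/repeatedPn[i i1]]; last first.
  by rewrite (bigD1 i) //= i1 cmoment1 mul0r normr0 mul0r.
rewrite mul1r normr_prod (bigID [pred i | i \in codom e]) /=.
rewrite [X in _ * X]big1 ?mulr1; last first.
  move=> i ie; rewrite (_ : #|_| = 0%N) ?cmoment0 ?normr1 //.
  apply: eq_card0 => t; rewrite !inE; apply/negP => /eqP et.
  by move: ie; rewrite -et codom_f.
rewrite -prodr_const; apply: ler_prod => i ie; rewrite normr_ge0 /=.
have /andP[p0 pq'] := pq i.
case E : #|_| (repeated_card i rep) => [|[|m]] // _.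
  move/codomP: ie => [t et]; have := card0_eq E t.
  by rewrite !inE et eqxx.
by rewrite (le_trans (cmoment_abs_le _ _)) ?p0 ?(le_trans pq').
Qed.

Lemma Ebern_third_ge (T : finType) (e : T -> I) :
  (repeated e)%:R * 3 ^- #|T| <=
  Ebern (fun=> 3^-1) (fun b => \prod_t ((b (e t))%:R - 3^-1)).
Proof.
rewrite (@Ebern_positions (fun=> 3^-1)).
case: (boolP (repeated e)) => [rep|_]; last first.
  by rewrite mul0r prodr_ge0 // => i _; exact: cmoment_third_ge0.
rewrite mul1r.
have -> : 3 ^- #|T| = \prod_i 3 ^- #|[pred t | e t == i]| :> R.
  rewrite -exprVn -prodr_const.
  rewrite (partition_big e xpredT) //=; apply: eq_bigr => i _.
  by rewrite -exprVn -prodr_const; apply: eq_bigl => t; rewrite !inE.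
apply: ler_prod => i _; rewrite cmoment_third_ge ?repeated_card // andbT.
by rewrite invr_ge0 exprn_ge0 // ler0n.
Qed.

End bernoulli.

(** * Closed walks and their shapes *)

Section walks.

Definition fcons (T : Type) k (a : T) (f : {ffun 'I_k -> T}) : {ffun 'I_k.+1 -> T} :=
  [ffun i => oapp f a (unlift ord0 i)].

Lemma fcons0 T k (a : T) (f : {ffun 'I_k -> T}) : fcons a f ord0 = a.
Proof. by rewrite ffunE unlift_none. Qed.

Lemma fconsS T k (a : T) (f : {ffun 'I_k -> T}) i : fcons a f (lift ord0 i) = f i.
Proof. by rewrite ffunE liftK. Qed.

Lemma sum_fcons (R : nmodType) (T : finType) k (F : {ffun 'I_k.+1 -> T} -> R) :
  \sum_x F x = \sum_a \sum_f F (fcons a f).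
Proof.
rewrite pair_big /=.
rewrite (reindex (fun p : T * {ffun 'I_k -> T} => fcons p.1 p.2)) //=.
exists (fun x => (x ord0, [ffun i => x (lift ord0 i)])) => [[a f]|x] _ /=.
  by rewrite fcons0; congr (_, _); apply/ffunP => i; rewrite ffunE fconsS.
apply/ffunP => i; rewrite ffunE; case: unliftP => [j ->|->] //=.
by rewrite ffunE.
Qed.

(** The closed walk reads [x_0 y_0 x_1 y_1 ...]: position [(false, i)] is the step between [x_i] and
    [y_i], and [(true, i)] the one between [y_i] and [x_(i+1)]. Row and column indices are distinct
    vertex classes even when equal as numbers. *)
Definition edge n k (x : {ffun 'I_k.+1 -> 'I_n}) (y : {ffun 'I_k -> 'I_n})
    (t : bool * 'I_k) : 'I_n * 'I_n :=
  (if t.1 then x (lift ord0 t.2) else x (widen_ord (leqnSn k) t.2), y t.2).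

Lemma exp_path_sum (R : comPzRingType) n (S : 'M[R]_n) k a b :
  (S ^+ k) a b = \sum_(x : {ffun 'I_k.+1 -> 'I_n})
     ((x ord0 == a) && (x ord_max == b))%:R *
     \prod_i S (x (widen_ord (leqnSn k) i)) (x (lift ord0 i)).
Proof.
elim: k a => [|k IH] a.
  rewrite expr0 sum_fcons.
  have E c (f : {ffun 'I_0 -> 'I_n}) : ((fcons c f ord0 == a) && (fcons c f ord_max == b))%:R *
     \prod_i S (fcons c f (widen_ord (leqnSn 0) i)) (fcons c f (lift ord0 i)) =
     ((c == a) && (c == b))%:R :> R.
    rewrite big_ord0 mulr1 fcons0; have -> : ord_max = ord0 :> 'I_1 by exact: val_inj.
    by rewrite fcons0.
  under eq_bigr do under eq_bigr do rewrite E.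
  under eq_bigr do rewrite sumr_const card_ffun !card_ord expn0 mulr1n.
  rewrite (bigD1 a) //= eqxx big1 ?addr0 ?mxE // => c ca.
  by rewrite (negbTE ca).
rewrite exprS mxE sum_fcons.
rewrite [RHS](bigD1 a) //= [X in _ + X]big1 ?addr0; last first.
  move=> c ca; rewrite big1 // => f _.
  by rewrite fcons0 (negbTE ca) mul0r.
under eq_bigr do rewrite IH mulr_sumr.
rewrite exchange_big; apply: eq_bigr => f _ /=.
rewrite fcons0 eqxx /= (bigD1 (f ord0)) //= [X in _ + X]big1 ?addr0; last first.
  by move=> c /negbTE cf; rewrite eq_sym cf mul0r mulr0.
have -> : ord_max = lift ord0 (@ord_max k) by apply: val_inj.
rewrite fconsS eqxx /= mulrCA; congr (_ * _).
rewrite [RHS]big_ord_recl fconsS.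
have -> : widen_ord (leqnSn k.+1) ord0 = ord0 by apply: val_inj.
rewrite fcons0; congr (_ * _); apply: eq_bigr => i _.
have -> : widen_ord (leqnSn k.+1) (lift ord0 i) = lift ord0 (widen_ord (leqnSn k) i).
  by apply: val_inj.
by rewrite !fconsS.
Qed.

Lemma trace_walks (R : comPzRingType) n (M : 'M[R]_n) k :
  \tr ((M *m M^T) ^+ k) =
  \sum_(x : {ffun 'I_k.+1 -> 'I_n}) \sum_(y : {ffun 'I_k -> 'I_n})
     (x ord0 == x ord_max)%:R * \prod_t M (edge x y t).1 (edge x y t).2.
Proof.
rewrite /mxtrace; under eq_bigr do rewrite exp_path_sum.
rewrite exchange_big; apply: eq_bigr => x _ /=.
rewrite -mulr_suml.
have -> : \sum_i ((x ord0 == i) && (x ord_max == i))%:R = (x ord0 == x ord_max)%:R :> R.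
  rewrite (bigD1 (x ord0)) //= eqxx [X in _ + X]big1 ?addr0 1?eq_sym //.
  by move=> i ix; rewrite eq_sym (negbTE ix).
rewrite -mulr_sumr; congr (_ * _).
under eq_bigr do rewrite mxE.
rewrite bigA_distr_bigA; apply: eq_bigr => y _.
rewrite -(pair_big xpredT xpredT (fun b i => M (edge x y (b, i)).1 (edge x y (b, i)).2)) /=.
by rewrite big_bool -big_split; apply: eq_bigr => i _ /=; rewrite mxE mulrC.
Qed.

(** A shape is the partition of the positions by equality of labels; comparing labellings directly
    avoids choosing canonical representatives. *)
Definition same_shape K n r (x : {ffun 'I_K -> 'I_n}) (x' : {ffun 'I_K -> 'I_r}) : bool :=
  [forall i, forall j, (x i == x j) == (x' i == x' j)].

Lemma same_shapeP K n r (x : {ffun 'I_K -> 'I_n}) (x' : {ffun 'I_K -> 'I_r}) :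
  reflect (forall i j, (x i == x j) = (x' i == x' j)) (same_shape x x').
Proof.
apply: (iffP forallP) => [H i j|H i].
  by have /forallP/(_ j)/eqP := H i.
by apply/forallP => j; rewrite H.
Qed.

Lemma same_shape_sym K n r (x : {ffun 'I_K -> 'I_n}) (x' : {ffun 'I_K -> 'I_r}) :
  same_shape x x' = same_shape x' x.
Proof.
by apply/idP/idP => /same_shapeP H; apply/same_shapeP => i j; rewrite H.
Qed.

Lemma same_shape_compl K n r (x : {ffun 'I_K -> 'I_n}) (x' : {ffun 'I_K -> 'I_r}) :
  same_shape x x' ->
  exists g : {ffun {v | v \in codom x} -> 'I_r},
    injective g /\ x' = [ffun i => g (Sub (x i) (codom_f x i))].
Proof.
move=> /same_shapeP H.
have ex (v : {v | v \in codom x}) : {i | val v == x i}.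
  by apply: sigW; case/codomP: (valP v) => j ->; exists j.
exists [ffun v => x' (sval (ex v))]; split.
  move=> u v; rewrite !ffunE => /eqP; rewrite -H.
  by case: (ex u) => i /= /eqP <-; case: (ex v) => j /= /eqP <- /eqP/val_inj.
apply/ffunP => i; rewrite !ffunE; case: (ex _) => j /= /eqP E.
by apply/eqP; rewrite -H E.
Qed.

Lemma same_shape_codom K n r (x : {ffun 'I_K -> 'I_n}) (x' : {ffun 'I_K -> 'I_r}) :
  same_shape x x' -> #|codom x| = #|codom x'|.
Proof.
wlog: n r x x' / true => [H|_]; first exact: H.
suff W n' r' (u : {ffun 'I_K -> 'I_n'}) (u' : {ffun 'I_K -> 'I_r'}) :
    same_shape u u' -> (#|codom u| <= #|codom u'|)%N.
  by move=> s; apply/eqP; rewrite eqn_leq !W // same_shape_sym.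
move=> /same_shape_compl[g [gi ->]].
rewrite -[X in (X <= _)%N](card_sig (mem (codom u))) -(card_codom gi).
apply/subset_leq_card/fintype.subsetP => _ /codomP[[v vu] ->].
have [i E] : exists i, v = u i by exact/codomP.
apply/codomP; exists i; rewrite ffunE.
by congr (g _); apply: val_inj.
Qed.

Lemma card_same_shape_le K n r (x' : {ffun 'I_K -> 'I_r}) :
  (#|[pred x : {ffun 'I_K -> 'I_n} | same_shape x x']| <= n ^ #|codom x'|)%N.
Proof.
pose D : finType := {v | v \in codom x'}.
have -> : (n ^ #|codom x'| = #|{ffun D -> 'I_n}|)%N by rewrite card_ffun card_ord card_sig.
pose F (g : {ffun D -> 'I_n}) : {ffun 'I_K -> 'I_n} := [ffun i => g (Sub (x' i) (codom_f x' i))].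
apply: leq_trans (leq_image_card F _).
apply/subset_leq_card/fintype.subsetP => x; rewrite inE same_shape_sym.
by move=> /same_shape_compl[g [_ ->]]; exact: codom_f.
Qed.

Lemma card_same_shape_ge K n r (x : {ffun 'I_K -> 'I_n}) :
  (r ^_ #|codom x| <= #|[pred x' : {ffun 'I_K -> 'I_r} | same_shape x x']|)%N.
Proof.
pose D : finType := {v | v \in codom x}.
have -> : (r ^_ #|codom x| = #|[set f : {ffun D -> 'I_r} | injectiveb f]|)%N.
  by rewrite card_inj_ffuns card_ord card_sig.
pose F (g : {ffun D -> 'I_r}) : {ffun 'I_K -> 'I_r} := [ffun i => g (Sub (x i) (codom_f x i))].
rewrite -(@card_in_imset _ _ F); last first.
  move=> g h _ _ /ffunP gh; apply/ffunP => -[v vx].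
  have [i E] : exists i, v = x i by exact/codomP.
  have := gh i; rewrite !ffunE.
  by rewrite (_ : Sub _ _ = exist _ v vx) //; apply: val_inj.
apply/subset_leq_card/fintype.subsetP => _ /imsetP[g + ->]; rewrite inE => /injectiveP gi.
rewrite inE; apply/same_shapeP => i j; rewrite !ffunE (inj_eq gi).
by rewrite -val_eqE.
Qed.

Lemma ffact_ge r K V : (V <= K -> (r - K) ^ V <= r ^_ V)%N.
Proof.
move=> VK; rewrite ffact_prod -[X in (_ ^ X <= _)%N]card_ord -prod_nat_const.
by apply: leq_prod => i _; have := ltn_ord i; lia.
Qed.

(** Double counting. A labelling [x] with V distinct labels is charged to its at least
    [(r - K) ^ V >= m ^ V] companions [x'] of the same shape, each taking the share [(q / m) ^ V].
    Each [x'] is charged by at most [n ^ V] labellings, hence in total at most [(n q / m) ^ V <= 1]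
    times [g x']. *)
Lemma shape_sum (R : realFieldType) K n r m (q : R)
    (f : {ffun 'I_K -> 'I_n} -> R) (g : {ffun 'I_K -> 'I_r} -> R) :
  0 <= q -> n%:R * q <= m%:R -> (0 < m)%N -> (m + K <= r)%N ->
  (forall x', 0 <= g x') ->
  (forall x x', same_shape x x' -> f x <= g x') ->
  \sum_(x : {ffun 'I_K -> 'I_n}) q ^+ #|codom x| * f x <= \sum_x' g x'.
Proof.
move=> q0 nqm m0 mKr g0 fg; have m0' : 0 < m%:R :> R by rewrite ltr0n.
have step (x : {ffun 'I_K -> 'I_n}) : q ^+ #|codom x| * f x <=
    \sum_(x' : {ffun 'I_K -> 'I_r} | same_shape x x') (q / m%:R) ^+ #|codom x'| * g x'.
  have -> : \sum_(x' : {ffun 'I_K -> 'I_r} | same_shape x x') (q / m%:R) ^+ #|codom x'| * g x' =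
      (q / m%:R) ^+ #|codom x| * \sum_(x' | same_shape x x') g x'.
    by rewrite mulr_sumr; apply: eq_bigr => x' /same_shape_codom ->.
  rewrite exprMn -mulrA ler_wpM2l ?exprn_ge0 // exprVn ler_pdivlMl ?exprn_gt0 //.
  have [f0|f0] := leP 0 (f x); last first.
    apply: (@le_trans _ _ 0); last exact: sumr_ge0.
    by rewrite nmulr_lle0 // exprn_ge0 // ltW.
  apply: (@le_trans _ _ (\sum_(x' : {ffun 'I_K -> 'I_r} | same_shape x x') f x)).
    rewrite sumr_const -[X in _ <= X]mulr_natl ler_wpM2r // -natrX ler_nat.
    apply: leq_trans (card_same_shape_ge r x).
    apply: leq_trans (@ffact_ge r K _ _); last first.
      by rewrite -[X in (_ <= X)%N](card_ord K) leq_image_card.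
    by case: #|_| => // V; rewrite leq_exp2r //; lia.
  by apply: ler_sum => x' /fg.
apply: le_trans (ler_sum _ (fun x _ => step x)) _.
rewrite (exchange_big_dep xpredT) //=; apply: ler_sum => x' _.
rewrite sumr_const -mulrnAl ler_piMl // -[X in X <= _]mulr_natl.
apply: (@le_trans _ _ ((n ^ #|codom x'|)%:R * (q / m%:R) ^+ #|codom x'|)).
  rewrite ler_wpM2r ?exprn_ge0 ?divr_ge0 // ?ler0n // ler_nat.
  exact: card_same_shape_le.
rewrite natrX -exprMn exprn_ile1 //; first by rewrite mulr_ge0 ?divr_ge0 ?ler0n.
by rewrite mulrA ler_pdivrMr // mul1r.
Qed.

End walks.

(** * Vertices against edges of a walk *)

Section walk_vertices.

(** The walk as lists over [nat]-indexed sequences, latest step first, so that induction on its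
    length needs no change of ordinal type. *)
Fixpoint walk_edges (T T' : Type) (X : nat -> T) (Y : nat -> T') k : seq (T * T') :=
  if k is k'.+1 then [:: (X k, Y k'), (X k', Y k') & walk_edges X Y k'] else [::].

Fixpoint downto (T : Type) (X : nat -> T) k : seq T :=
  if k is k'.+1 then X k' :: downto X k' else [::].

Lemma mem_downto (T : eqType) (X : nat -> T) k i : (i < k)%N -> X i \in downto X k.
Proof.
elim: k => // k IH; rewrite ltnS leq_eqVlt => /predU1P[->|/IH]; rewrite inE ?eqxx // => ->.
by rewrite orbT.
Qed.

Lemma mem_walk_edges (T T' : eqType) (X : nat -> T) (Y : nat -> T') k u v :
  (u, v) \in walk_edges X Y k -> (u \in downto X k.+1) && (v \in downto Y k).
Proof.
elim: k => // k IH; rewrite /= !inE => /or3P[/eqP[-> ->]|/eqP[-> ->]|/IH /andP[/= h ->]].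
- by rewrite !eqxx.
- by rewrite !eqxx !orbT.
- by move: h; rewrite inE => ->; rewrite !orbT.
Qed.

Lemma walk_vertices_seq (T T' : eqType) (X : nat -> T) (Y : nat -> T') k :
  (size (undup (downto X k.+1)) + size (undup (downto Y k)) <=
   (size (undup (walk_edges X Y k))).+1)%N.
Proof.
have undupC (U : eqType) (u : U) (r : seq U) :
  size (undup (u :: r)) = ((u \notin r) + size (undup r))%N by rewrite /=; case: ifP.
elim: k => // k IH.
have e1 := undupC _ (X k.+1) (downto X k.+1); have e2 := undupC _ (Y k) (downto Y k).
have e3 := undupC _ (X k.+1, Y k) ((X k, Y k) :: walk_edges X Y k).
have e4 := undupC _ (X k, Y k) (walk_edges X Y k).
have H1 : (Y k \notin downto Y k) ==> ((X k, Y k) \notin walk_edges X Y k).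
  by apply/implyP; apply: contra => /mem_walk_edges/andP[].
have H2 : (X k.+1 \notin downto X k.+1) ==>
    ((X k.+1, Y k) \notin (X k, Y k) :: walk_edges X Y k).
  apply/implyP; apply: contra; rewrite in_cons => /predU1P[[->]|/mem_walk_edges/andP[]//].
  by rewrite mem_downto.
rewrite -[downto X k.+2]/(X k.+1 :: downto X k.+1) e1.
rewrite -[downto Y k.+1]/(Y k :: downto Y k) e2.
rewrite -[walk_edges X Y k.+1]/[:: (X k.+1, Y k), (X k, Y k) & walk_edges X Y k] e3 e4.
move: H1 H2 IH; clear.
move: (size (undup (downto X k.+1))) (size (undup (downto Y k))) => a b.
move: (size _) => c; do 4!move: (_ \notin _) => ?; lia.
Qed.

Lemma walk_vertices n k (x : {ffun 'I_k.+1 -> 'I_n}) (y : {ffun 'I_k -> 'I_n}) :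
  (#|codom x| + #|codom y| <= #|codom (edge x y)|.+1)%N.
Proof.
(* The empty walk is separate because [inord] needs a nonempty ordinal type for [y]. *)
case: k x y => [|k] x y.
  have hx : (#|codom x| <= #|'I_1|)%N by exact: leq_image_card.
  have hy : (#|codom y| <= #|'I_0|)%N by exact: leq_image_card.
  rewrite !card_ord in hx hy; lia.
pose X i := x (inord i); pose Y i := y (inord i).
have hX : (#|codom x| <= size (undup (downto X k.+2)))%N.
  rewrite -(card_uniqP (undup_uniq _)); apply/subset_leq_card/fintype.subsetP => _ /codomP[i ->].
  by rewrite mem_undup -(inord_val i) mem_downto.
have hY : (#|codom y| <= size (undup (downto Y k.+1)))%N.
  rewrite -(card_uniqP (undup_uniq _)); apply/subset_leq_card/fintype.subsetP => _ /codomP[i ->].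
  by rewrite mem_undup -(inord_val i) mem_downto.
have hE : (size (undup (walk_edges X Y k.+1)) <= #|codom (edge x y)|)%N.
  rewrite -(card_uniqP (undup_uniq _)); apply/subset_leq_card/fintype.subsetP => e.
  rewrite mem_undup => ew.
  suff [t ->] : exists t, e = edge x y t by exact: codom_f.
  have : exists2 i, (i < k.+1)%N & e = (X i, Y i) \/ e = (X i.+1, Y i).
    elim: k.+1 ew => // j IH; rewrite /= !inE => /or3P[/eqP->|/eqP->|/IH[i ij H]].
    - by exists j => //; right.
    - by exists j => //; left.
    - by exists i => //; exact: leq_trans ij _.
  move=> [i ik [->|->]].
    exists (false, inord i); rewrite /edge /=; congr (x _, _).
    by apply: val_inj; rewrite /= !inordK //; lia.
  exists (true, inord i); rewrite /edge /=; congr (x _, _).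
  by apply: val_inj; rewrite /= /bump /= !inordK //; lia.
apply: leq_trans (leq_add hX hY) _; apply: leq_trans (walk_vertices_seq X Y k.+1) _.
by rewrite ltnS.
Qed.

End walk_vertices.

(** * Sparse against dense trace moments *)

Section comparison.
Variable R : realFieldType.

Definition centered n (p : 'I_n * 'I_n -> R) (b : {ffun 'I_n * 'I_n -> bool}) : 'M[R]_n :=
  \matrix_(i, j) ((b (i, j))%:R - p (i, j)).

Lemma Ebern_trace n (p : 'I_n * 'I_n -> R) k :
  Ebern p (fun b => \tr ((centered p b *m (centered p b)^T) ^+ k)) =
  \sum_(x : {ffun 'I_k.+1 -> 'I_n}) \sum_(y : {ffun 'I_k -> 'I_n})
    (x ord0 == x ord_max)%:R *
    Ebern p (fun b => \prod_t ((b (edge x y t))%:R - p (edge x y t))).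
Proof.
transitivity (Ebern p (fun b => \sum_(x : {ffun 'I_k.+1 -> 'I_n})
  \sum_(y : {ffun 'I_k -> 'I_n}) (x ord0 == x ord_max)%:R *
     \prod_t ((b (edge x y t))%:R - p (edge x y t)))).
  apply: eq_bigr => b _; congr (_ * _); rewrite trace_walks.
  apply: eq_bigr => x _; apply: eq_bigr => y _; congr (_ * _).
  by apply: eq_bigr => t _; rewrite mxE -surjective_pairing.
rewrite Ebern_sum; apply: eq_bigr => x _; rewrite Ebern_sum.
by apply: eq_bigr => y _; rewrite EbernZ.
Qed.

Lemma repeated_shape n r k (x : {ffun 'I_k.+1 -> 'I_n}) (y : {ffun 'I_k -> 'I_n})
    (x' : {ffun 'I_k.+1 -> 'I_r}) (y' : {ffun 'I_k -> 'I_r}) :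
  same_shape x x' -> same_shape y y' -> repeated (edge x y) = repeated (edge x' y').
Proof.
move=> /same_shapeP hx /same_shapeP hy.
apply: eq_forallb => t; apply: eq_existsb => t'; congr (_ && _).
by rewrite /edge !xpair_eqE hy; case: t'.1; case: t.1; rewrite hx.
Qed.

(* Bandeira--van Handel: walks of a given shape are at most [n ^ V] in number in the
   sparse matrix, with weight at most [q ^ (V - 1)], against at least [k ^ V] in a
   dense [r x r] matrix with [n q <= k]. *)
Lemma trace_comparison n r k (p : 'I_n * 'I_n -> R) q :
  (0 < k)%N -> (k + k.+1 <= r)%N -> q <= 1 -> n%:R * q <= k%:R -> 0 <= q ->
  (forall e, 0 <= p e <= q) ->
  q * Ebern p (fun b => \tr ((centered p b *m (centered p b)^T) ^+ k)) <=
  9 ^+ k * Ebern (fun=> 3^-1)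
    (fun b : {ffun 'I_r * 'I_r -> bool} =>
       \tr ((centered (fun=> 3^-1) b *m (centered (fun=> 3^-1) b)^T) ^+ k)).
Proof.
move=> k0 kr q1 nqk q0 pq; rewrite !Ebern_trace.
pose h m (x : {ffun 'I_k.+1 -> 'I_m}) (y : {ffun 'I_k -> 'I_m}) : R :=
  (x ord0 == x ord_max)%:R * (repeated (edge x y))%:R.
apply: (@le_trans _ _ (\sum_(x : {ffun 'I_k.+1 -> 'I_n}) q ^+ #|codom x| *
    \sum_(y : {ffun 'I_k -> 'I_n}) q ^+ #|codom y| * h n x y)).
  rewrite mulr_sumr; apply: ler_sum => x _; rewrite !mulr_sumr; apply: ler_sum => y _.
  rewrite /h mulrCA [X in _ <= X](_ : _ = (x ord0 == x ord_max)%:R *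
    (q ^+ (#|codom x| + #|codom y|) * (repeated (edge x y))%:R)); last by rewrite exprD; ring.
  rewrite ler_wpM2l ?ler0n //.
  apply: le_trans (ler_wpM2l q0 (le_trans (ler_norm _) (Ebern_positions_le _ pq q1))) _.
  rewrite mulrCA [X in _ <= X]mulrC ler_wpM2l ?ler0n // -exprS.
  (* As [q <= 1], the bound V <= E + 1 turns [q ^ (E + 1)] into at most [q ^ V]; the exponent E + 1
     is where the leading [q] of the statement is spent. *)
  by apply: ler_wiXn2l => //; exact: walk_vertices.
apply: (@le_trans _ _ (\sum_(x : {ffun 'I_k.+1 -> 'I_r}) \sum_(y : {ffun 'I_k -> 'I_r}) h r x y)).
  have h0 m x y : 0 <= h m x y by rewrite mulr_ge0 ?ler0n.
  (* The row labels are transferred first, with the sum over column labels as integrand; then the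
     column labels. *)
  apply: (@shape_sum _ _ _ _ k) => // [x'|x x' xx']; first exact: sumr_ge0.
  apply: (@shape_sum _ _ _ _ k) => // [|y y' yy']; first by lia.
  rewrite /h (repeated_shape xx' yy').
  by move/same_shapeP: xx' => ->.
rewrite mulr_sumr; apply: ler_sum => x _; rewrite !mulr_sumr; apply: ler_sum => y _.
rewrite mulrCA /h ler_wpM2l ?ler0n //.
have := Ebern_third_ge R (edge x y).
rewrite card_prod card_bool card_ord exprM -[_ ^+ 2]/(3 * 3) -natrM.
by rewrite ler_pdivrMr ?exprn_gt0 ?ltr0n // mulrC.
Qed.

End comparison.

(** * The dense comparison matrix *)

Section subgaussian.
Variable R : realType.

(** Squaring [1 - x / 2 <= exp (- x / 2)] gives [exp x <= (1 - x / 2) ^- 2], which leaves a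
    polynomial inequality. *)
Lemma expR_le_quadratic (x : R) : x <= 1 -> expR x <= 1 + x + 2 * x ^+ 2.
Proof.
move=> x1; have h : 1 - x / 2 <= expR (- (x / 2)) by exact: expR_ge1Dx.
have h0 : 0 < 1 - x / 2 by lra.
have E : expR (- (x / 2)) ^+ 2 * expR x = 1.
  by rewrite -expRM_natl -expRD (_ : _ + x = 0) ?expR0 //; lra.
have h2 : (1 - x / 2) ^+ 2 <= expR (- (x / 2)) ^+ 2.
  by rewrite lerXn2r ?nnegrE ?expR_ge0 // ltW.
have h3 : (1 - x / 2) ^+ 2 * expR x <= 1.
  by rewrite -[X in _ <= X]E ler_wpM2r ?expR_ge0.
have h4 : 1 <= (1 + x + 2 * x ^+ 2) * (1 - x / 2) ^+ 2.
  have -> : (1 + x + 2 * x ^+ 2) * (1 - x / 2) ^+ 2 =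
    1 + x ^+ 2 * ((1 - x) * (5 / 4 - x / 2)) by field.
  by rewrite lerDl mulr_ge0 ?sqr_ge0 // mulr_ge0; lra.
by rewrite -(@ler_pM2l _ ((1 - x / 2) ^+ 2)) ?exprn_gt0 // (le_trans h3) // mulrC.
Qed.

(** This form suits centred variables: the linear term has mean zero, and what remains is already a
    Gaussian-type exponential. *)
Lemma expR_le_linear (x : R) : expR x <= x + expR (2 * x ^+ 2).
Proof.
have [x1|x1] := leP x 1.
  apply: le_trans (expR_le_quadratic x1) _.
  have := expR_ge1Dx (2 * x ^+ 2); lra.
apply: (@le_trans _ _ (expR (2 * x ^+ 2))); last by lra.
by rewrite ler_expR expr2; nra.
Qed.

Lemma expR_bernoulli_third (t : R) :
  3^-1 * expR (t * (1 - 3^-1)) + (1 - 3^-1) * expR (t * (0 - 3^-1)) <=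
  expR (2 * t ^+ 2).
Proof.
have h1 := expR_le_linear (t * (1 - 3^-1)).
have h2 := expR_le_linear (t * (0 - 3^-1)).
have t2 := sqr_ge0 t.
have h3 : expR (2 * (t * (1 - 3^-1)) ^+ 2) <= expR (2 * t ^+ 2) by rewrite ler_expR; nra.
have h4 : expR (2 * (t * (0 - 3^-1)) ^+ 2) <= expR (2 * t ^+ 2) by rewrite ler_expR; nra.
lra.
Qed.

Lemma Ebern_third_expR (I : finType) (c : I -> R) :
  Ebern (fun=> 3^-1) (fun b => expR (\sum_i c i * ((b i)%:R - 3^-1))) <=
  expR (2 * \sum_i c i ^+ 2).
Proof.
rewrite mulr_sumr !expR_sum.
under [Ebern _ _]eq_bigr do rewrite expR_sum.
rewrite [X in X <= _](Ebern_prod (fun=> 3^-1) (fun i v => expR (c i * (v%:R - 3^-1)))).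
apply: ler_prod => i _; rewrite expR_bernoulli_third andbT.
by rewrite addr_ge0 // mulr_ge0 ?expR_ge0 //; lra.
Qed.

Lemma expn_le_expR (x : R) k : (0 < k)%N ->
  x ^+ (2 * k) <= (2 * k)%:R ^+ (2 * k) * (expR x + expR (- x)).
Proof.
move=> k0; set m := (2 * k)%N; have m0 : 0 < m%:R :> R by rewrite ltr0n muln_gt0.
have H (y : R) : 0 <= y -> y ^+ m <= m%:R ^+ m * expR y.
  move=> y0; have h : y / m%:R <= expR (y / m%:R).
    by have := expR_ge1Dx (y / m%:R); lra.
  have -> : expR y = expR (y / m%:R) ^+ m.
    by rewrite -expRM_natl mulrC divfK // gt_eqF.
  rewrite -exprMn lerXn2r ?nnegrE ?mulr_ge0 ?expR_ge0 ?ler0n //.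
  by rewrite mulrC -ler_pdivrMr.
have [x0|x0] := leP 0 x.
  apply: le_trans (H _ x0) _; rewrite ler_wpM2l ?exprn_ge0 ?ler0n //.
  by rewrite lerDl expR_ge0.
have -> : x ^+ m = (- x) ^+ m by rewrite /m !exprM sqrrN.
apply: le_trans (H (- x) _) _; first by lra.
by rewrite ler_wpM2l ?exprn_ge0 ?ler0n // lerDr expR_ge0.
Qed.

Lemma third01 (I : finType) : forall i : I, 0 <= (fun=> 3^-1 : R) i <= 1.
Proof. by move=> i; apply/andP; split; lra. Qed.

Lemma Ebern_third_pow (I : finType) (c : I -> R) k : (0 < k)%N ->
  Ebern (fun=> 3^-1) (fun b => (\sum_i c i * ((b i)%:R - 3^-1)) ^+ (2 * k)) <=
  2 * (2 * k)%:R ^+ (2 * k) * expR (2 * \sum_i c i ^+ 2).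
Proof.
move=> k0; apply: le_trans (Ebern_le (third01 (I := I)) (fun b => expn_le_expR _ k0)) _.
rewrite EbernZ EbernD [X in _ <= X * _]mulrC -mulrA; apply: ler_wpM2l; first by rewrite exprn_ge0 ?ler0n.
have h1 := Ebern_third_expR c.
have h2 := Ebern_third_expR (fun i => - c i).
have E : \sum_i (- c i) ^+ 2 = \sum_i c i ^+ 2 by apply: eq_bigr => i _; rewrite sqrrN.
rewrite E in h2.
rewrite [X in _ <= X](_ : _ = expR (2 * \sum_i c i ^+ 2) + expR (2 * \sum_i c i ^+ 2)); last by ring.
apply: lerD => //; apply: le_trans h2.
rewrite le_eqVlt; apply/orP; left; apply/eqP; apply: eq_bigr => b _.
congr (_ * expR _); rewrite -sumrN; apply: eq_bigr => i _; ring.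
Qed.

End subgaussian.

(** * Lattice nets of the ball *)

Section net.
Variables (R : realType) (r B : nat).

(** Integer coordinates are stored as sign and size. Zero then has two codes, which is harmless as
    the net is only counted from above. *)
Definition lattice_vec (z : {ffun 'I_r -> bool * 'I_B.+1}) : 'cV[R]_r :=
  \col_i ((-1) ^+ (z i).1 * (z i).2%:R).

Definition in_net (z : {ffun 'I_r -> bool * 'I_B.+1}) : bool :=
  (\sum_i (z i).2 ^ 2 <= B ^ 2)%N.

Lemma sqn_col n (v : 'cV[R]_n) : sqn v = \sum_i v i 0 ^+ 2.
Proof. by apply: eq_bigr => i _; rewrite big_ord1. Qed.

Lemma sqn_lattice z : sqn (lattice_vec z) = (\sum_i (z i).2 ^ 2)%:R.
Proof.
rewrite sqn_col natr_sum; apply: eq_bigr => i _.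
by rewrite mxE exprMn sqrr_sign mul1r natrX.
Qed.

(** Coordinates are truncated towards zero, so the rounded vector stays in the ball of radius [B]
    and each coordinate moves by less than 1. *)
Lemma round_net (x : 'cV[R]_r) : sqn x <= 1 ->
  exists2 z, in_net z & sqn (B%:R *: x - lattice_vec z) <= r%:R.
Proof.
move=> x1; pose j i := Num.truncn (B%:R * `|x i 0|).
have jle i : (j i)%:R <= B%:R * `|x i 0| by rewrite truncn_le mulr_ge0.
have jB i : (j i < B.+1)%N.
  rewrite ltnS -(@ler_nat R) (le_trans (jle i)) // ler_piMr ?ler0n //.
  rewrite -(@ler_pXn2r _ 2) ?nnegrE // real_normK ?num_real // expr1n.
  by rewrite (le_trans _ x1) // sqn_entry.
exists [ffun i => (x i 0 < 0, Ordinal (jB i))].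
  rewrite /in_net -(@ler_nat R) natr_sum.
  apply: (@le_trans _ _ (B%:R ^+ 2 * sqn x)).
    rewrite sqn_col mulr_sumr; apply: ler_sum => i _; rewrite ffunE /= natrX.
    rewrite -[x i 0 ^+ 2]real_normK ?num_real // -exprMn.
    by rewrite lerXn2r ?nnegrE ?ler0n ?mulr_ge0.
  by rewrite natrX ler_piMr ?exprn_ge0 ?ler0n.
rewrite sqn_col; apply: (@le_trans _ _ (\sum_(i < r) 1)); last first.
  by rewrite sumr_const card_ord.
apply: ler_sum => i _; rewrite !mxE ffunE /=.
have -> : B%:R * x i 0 - (-1) ^+ (x i 0 < 0)%R * (j i)%:R =
    (-1) ^+ (x i 0 < 0)%R * (B%:R * `|x i 0| - (j i)%:R).
  by rewrite {1}[x i 0]numEsign; ring.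
rewrite exprMn sqrr_sign mul1r.
have h := truncnS_gt (B%:R * `|x i 0|); have h' := jle i.
by rewrite -natr1 -/(j i) in h; rewrite expr_le1 //; lra.
Qed.

(** On the net the sizes sum to at most [B ^ 2], an integer being at most its square. The indicator
    is therefore at most [2 ^ (B ^ 2)] times the product of the [2 ^- size], and each coordinate
    sums to at most 4 over both signs. *)
Lemma card_net_le : #|[pred z | in_net z]|%:R <= 2 ^+ (B ^ 2) * 4 ^+ r :> R.
Proof.
pose F (v : bool * 'I_B.+1) : R := 2 ^- v.2.
have F0 v : 0 <= F v by rewrite invr_ge0 exprn_ge0.
have step z : (in_net z)%:R <= 2 ^+ (B ^ 2) * \prod_i F (z i).
  case: (boolP (in_net z)) => [zn|_]; last first.
    by rewrite mulr_ge0 ?exprn_ge0 // prodr_ge0.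
  rewrite /F /= prodfV prodrXr ler_pdivlMr ?exprn_gt0 // mul1r.
  apply: ler_weXn2l; first by rewrite ler1n.
  apply: leq_trans zn; apply: leq_sum => i _; nia.
rewrite -sum1_card natr_sum big_mkcond /=.
apply: (@le_trans _ _ (\sum_(z : {ffun 'I_r -> bool * 'I_B.+1}) 2 ^+ (B ^ 2) * \prod_i F (z i))).
  by apply: ler_sum => z _; have := step z; rewrite inE; case: ifP.
rewrite -mulr_sumr ler_wpM2l ?exprn_ge0 //.
rewrite -(bigA_distr_bigA (fun _ v => F v)) /= prodr_const card_ord.
rewrite lerXn2r ?nnegrE ?sumr_ge0 //.
rewrite -(pair_big xpredT xpredT (fun b i => F (b, i))) /= big_bool /= /F /=.
suff H m : \sum_(i < m) 2 ^- i <= 2 - 2 * 2 ^- m :> R.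
  have h := H B.+1; have : 0 <= 2 ^- B.+1 :> R by rewrite invr_ge0 exprn_ge0.
  lra.
elim: m => [|m IH]; first by rewrite big_ord0 expr0; lra.
rewrite big_ord_recr /= exprS invfM.
have : 0 <= 2 ^- m :> R by rewrite invr_ge0 exprn_ge0.
move: IH; set a := \sum_(i < _) _; lra.
Qed.

End net.

Section net_norm.
Variable R : realType.

Definition bil n (M : 'M[R]_n) (x y : 'cV[R]_n) : R := (x^T *m M *m y) 0 0.

Lemma bil_sq_le n (M : 'M[R]_n) x y : bil M x y ^+ 2 <= sqn x * sqn M * sqn y.
Proof.
rewrite /bil -sqn11; apply: le_trans (sqn_mul _ _) _.
rewrite ler_wpM2r ?sqn_ge0 //; apply: le_trans (sqn_mul _ _) _.
by rewrite sqn_tr.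
Qed.

Lemma bilZ n (M : 'M[R]_n) a b x y : bil M (a *: x) (b *: y) = a * b * bil M x y.
Proof.
rewrite /bil (_ : (a *: x)^T = a *: x^T); last by apply/matrixP => i j; rewrite !mxE.
by rewrite -!scalemxAl -scalemxAr scalerA mxE.
Qed.

Lemma bilDl n (M : 'M[R]_n) x x' y : bil M (x + x') y = bil M x y + bil M x' y.
Proof.
rewrite /bil (_ : (x + x')^T = x^T + x'^T); last by apply/matrixP => i j; rewrite !mxE.
by rewrite !mulmxDl mxE.
Qed.

Lemma bilDr n (M : 'M[R]_n) x y y' : bil M x (y + y') = bil M x y + bil M x y'.
Proof. by rewrite /bil mulmxDr mxE. Qed.

(* The sup [S] of the form over unit vectors satisfies [S <= l + S / 2], the lattice
   points scaled by [1 / B] being within [1 / 4] of every point of the ball. *)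
Lemma net_opb kappa (M : 'M[R]_(4 * kappa ^ 2)) (l : R) : (0 < kappa)%N -> 0 <= l ->
  (forall z w : {ffun 'I_(4 * kappa ^ 2) -> bool * 'I_(8 * kappa).+1},
     in_net z -> in_net w ->
     `|bil M (lattice_vec R z) (lattice_vec R w)| <= l * (8 * kappa)%:R ^+ 2) ->
  opb (4 * l ^+ 2) M.
Proof.
set r := (4 * kappa ^ 2)%N; set B := (8 * kappa)%N => k0 l0 H.
have B0 : 0 < B%:R :> R by rewrite ltr0n muln_gt0.
pose E : set R := [set t | exists x y : 'cV[R]_r,
  [/\ sqn x <= 1, sqn y <= 1 & t = `|bil M x y|]]%classic.
have sqn0 : sqn (0 : 'cV[R]_r) = 0.
  by rewrite sqn_col big1 // => i _; rewrite mxE expr0n.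
have bndE : ubound E (1 + sqn M).
  move=> _ [x [y [x1 y1 ->]]].
  rewrite -(@ler_pXn2r _ 2) ?nnegrE ?addr_ge0 ?sqn_ge0 // real_normK ?num_real //.
  apply: le_trans (bil_sq_le _ _ _) _.
  have M0 := sqn_ge0 M; have x0 := sqn_ge0 x; have y0 := sqn_ge0 y.
  apply: (@le_trans _ _ (sqn M)); last by rewrite expr2; nra.
  apply: (@le_trans _ _ (sqn x * sqn M)); first by rewrite ler_piMr ?mulr_ge0.
  by rewrite ler_piMl.
have supE : has_sup E.
  split; last by exists (1 + sqn M).
  by exists `|bil M 0 0|; exists 0, 0; rewrite sqn0.
set S := sup E.
have S0 : 0 <= S.
  have E0 : E `|bil M 0 0| by exists 0, 0; rewrite sqn0.
  exact: le_trans (normr_ge0 _) (sup_upper_bound supE E0).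
have hom (u v : 'cV[R]_r) a b : 0 < a -> 0 < b -> sqn u <= a ^+ 2 -> sqn v <= b ^+ 2 ->
    `|bil M u v| <= S * (a * b).
  move=> a0 b0 ua vb.
  have inE : E `|bil M (a^-1 *: u) (b^-1 *: v)|.
    by exists (a^-1 *: u), (b^-1 *: v); split => //;
      rewrite sqnZ exprVn ler_pdivrMl ?exprn_gt0 // mulr1.
  have := sup_upper_bound supE inE.
  rewrite bilZ normrM -invfM ger0_norm ?invr_ge0 ?mulr_ge0 ?(ltW a0) ?(ltW b0) //.
  by rewrite ler_pdivrMl ?mulr_gt0 // mulrC.
have SE : S <= l + S / 2.
  apply: ge_sup; first by case: supE.
  move=> _ [x [y [x1 y1 ->]]].
  have [z zn zr] := round_net B x1.
  have [w wn wr] := round_net B y1.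
  (* The dimension is 4 times a square so that its root is exactly [B / 4] with [B] an integer. *)
  have rB : r%:R = (B%:R / 4) ^+ 2 :> R.
    by rewrite /r /B !natrM; field.
  have zB : sqn (lattice_vec R z) <= B%:R ^+ 2.
    by rewrite sqn_lattice -natrX ler_nat.
  have yB : sqn (B%:R *: y) <= B%:R ^+ 2 by rewrite sqnZ ler_piMr ?exprn_ge0 // ltW.
  have B4 : 0 < B%:R / 4 :> R by rewrite divr_gt0.
  rewrite rB in zr wr.
  have h1 := hom _ _ _ _ B4 B0 zr yB.
  have h2 := hom _ _ _ _ B0 B4 zB wr.
  have h3 := H z w zn wn.
  have BB : 0 < B%:R ^+ 2 :> R by rewrite exprn_gt0.
  rewrite -(ler_pM2l BB).
  have -> : B%:R ^+ 2 * `|bil M x y| = `|bil M (B%:R *: x) (B%:R *: y)|.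
    by rewrite bilZ normrM ger0_norm ?mulr_ge0 ?ltW.
  rewrite -[B%:R *: x](subrK (lattice_vec R z)) bilDl.
  rewrite -[X in bil M (lattice_vec R z) X](subrK (lattice_vec R w)) bilDr.
  apply: le_trans (ler_normD _ _) _; apply: le_trans (lerD h1 (ler_normD _ _)) _.
  apply: le_trans (lerD (lexx _) (lerD h2 h3)) _.
  by rewrite le_eqVlt; apply/orP; left; apply/eqP; field.
have S2 : S <= 2 * l by lra.
move=> v.
have [->|v0] := eqVneq v 0; first by rewrite mulmx0 sqn0 mulr0.
have [->|Mv0] := eqVneq (M *m v) 0.
  by rewrite sqn0 mulr_ge0 ?sqn_ge0 // mulr_ge0 ?sqr_ge0.
have pos (u : 'cV[R]_r) : u != 0 -> 0 < sqn u.
  by move=> u0; rewrite lt_def sqn_ge0 andbT; apply: contra_neq u0; exact: sqn_eq0.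
have sq (u : 'cV[R]_r) : Num.sqrt (sqn u) ^+ 2 = sqn u by rewrite sqr_sqrtr ?sqn_ge0.
set a := Num.sqrt (sqn (M *m v)); set b := Num.sqrt (sqn v).
have a0 : 0 < a by rewrite sqrtr_gt0 pos.
have b0 : 0 < b by rewrite sqrtr_gt0 pos.
have ha : sqn (M *m v) = a ^+ 2 by rewrite sq.
have hb : sqn v = b ^+ 2 by rewrite sq.
(* Pairing [M v] with [v] turns the form into [sqn (M v) = a ^ 2 <= S a b]; cancelling [a] gives the
   operator bound. *)
have := hom (M *m v) v _ _ a0 b0.
rewrite ha hb => /(_ (lexx _) (lexx _)).
have -> : bil M (M *m v) v = a ^+ 2.
  by rewrite -ha -sqn_tr sqnE trmxK /mxtrace big_ord1 /bil !mulmxA.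
rewrite ger0_norm ?sqr_ge0 // expr2 mulrCA ler_pM2l // => aSb.
have ab : a <= 2 * l * b by apply: le_trans aSb _; rewrite ler_wpM2r // ltW.
have -> : 4 * l ^+ 2 * b ^+ 2 = (2 * l * b) ^+ 2 by ring.
by rewrite -expr2 lerXn2r ?nnegrE ?mulr_ge0 // ltW.
Qed.

End net_norm.

(** * Trace moment of the dense matrix *)

Section dense.
Variables (R : realType) (kappa : nat).
Hypothesis kappa_gt0 : (0 < kappa)%N.

Let k := (kappa ^ 2)%N.
Let r := (4 * kappa ^ 2)%N.
Let B := (8 * kappa)%N.
Let Z : finType := {ffun 'I_r -> bool * 'I_B.+1}.
Let Y (b : {ffun 'I_r * 'I_r -> bool}) : 'M[R]_r := centered (fun=> 3^-1) b.
Let form (zw : Z * Z) b : R :=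
  bil (Y b) (lattice_vec R zw.1) (lattice_vec R zw.2) / B%:R ^+ 2.
Let net : pred (Z * Z) := [pred zw | in_net zw.1 && in_net zw.2].

Let kappa0 : 0 < kappa%:R :> R. Proof. by rewrite ltr0n. Qed.
Let k0 : (0 < k)%N. Proof. by rewrite expn_gt0 kappa_gt0. Qed.
Let B0 : 0 < B%:R :> R. Proof. by rewrite ltr0n muln_gt0. Qed.

(** The largest form value on the net controls the operator norm, and its [2 k]-th power is at most
    the sum of all [2 k]-th powers, whose expectation is computable termwise. *)
Let trace_le_net b : \tr ((Y b *m (Y b)^T) ^+ k) <=
  r%:R * 4 ^+ k * \sum_(zw | net zw) form zw b ^+ (2 * k).
Proof.
set Sg := \sum_(zw | _) _.
have pw (x : R) : 0 <= x ^+ (2 * k) by rewrite exprM exprn_ge0 ?sqr_ge0.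
have S0 : 0 <= Sg by apply: sumr_ge0.
pose l : R := \big[Num.max/0]_(zw | net zw) `|form zw b|.
have [l0 lS] : 0 <= l /\ l ^+ (2 * k) <= Sg.
  rewrite /l; elim/big_rec: _ => [|zw x nzw [x0 xS]].
    by rewrite expr0n muln_eq0 /= gtn_eqF.
  have [_|_] := leP `|form zw b| x; split => //.
  rewrite exprM real_normK ?num_real // -exprM /Sg (bigD1 zw) //= lerDl.
  by apply: sumr_ge0.
have op : opb (4 * l ^+ 2) (Y b).
  apply: net_opb => // z w zn wn.
  have -> : `|bil (Y b) (lattice_vec R z) (lattice_vec R w)| = `|form (z, w) b| * B%:R ^+ 2.
    rewrite /form normrM normfV (@ger0_norm _ (B%:R ^+ 2)) ?exprn_ge0 ?ler0n // divfK //.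
    by rewrite expf_neq0 // gt_eqF.
  rewrite ler_wpM2r ?exprn_ge0 ?ler0n //.
  by apply: (le_bigmax_cond _ (fun zw => `|form zw b|)) => //=; rewrite /net /= zn wn.
apply: le_trans (tr_exp_le _ _ op) _; first by rewrite mulr_ge0 ?sqr_ge0.
by rewrite exprMn -exprM mulrA ler_wpM2l //.
Qed.

Let bil_centered (b : {ffun 'I_r * 'I_r -> bool}) (u v : 'cV[R]_r) :
  bil (Y b) u v = \sum_e (u e.1 0 * v e.2 0) * ((b e)%:R - 3^-1).
Proof.
rewrite /bil -mulmxA mxE.
under eq_bigr do rewrite mxE mxE mulr_sumr.
rewrite pair_big /=; apply: eq_bigr => -[i j] _.
by rewrite mxE /=; ring.
Qed.

Let form_moment zw : net zw ->
  Ebern (fun=> 3^-1) (fun b => form zw b ^+ (2 * k)) <= 2 * (4 * k%:R * expR 2) ^+ k.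
Proof.
case: zw => z w /andP[/= zn wn].
pose u := lattice_vec R z; pose v := lattice_vec R w.
(* Rescaling the form by [kappa], the root of [k], brings the variance proxy to order [k]. The bound
   [(2 k) ^ (2 k) * exp (2 k)] divided by [k ^ k] is then [(4 k e^2) ^ k], of the right order. *)
pose c (e : 'I_r * 'I_r) := kappa%:R / B%:R ^+ 2 * (u e.1 0 * v e.2 0).
have E b : form (z, w) b ^+ (2 * k) =
    kappa%:R ^- (2 * k) * (\sum_e c e * ((b e)%:R - 3^-1)) ^+ (2 * k).
  rewrite -exprVn -exprMn; congr (_ ^+ _).
  rewrite /form bil_centered mulr_suml mulr_sumr; apply: eq_bigr => e _.
  by rewrite /c -/u -/v; field; rewrite !gt_eqF.
have -> : Ebern (fun=> 3^-1) (fun b => form (z, w) b ^+ (2 * k)) =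
    kappa%:R ^- (2 * k) * Ebern (fun=> 3^-1)
      (fun b => (\sum_e c e * ((b e)%:R - 3^-1)) ^+ (2 * k)).
  by rewrite -EbernZ; apply: eq_bigr => b _; rewrite E.
have ck : \sum_e c e ^+ 2 <= k%:R.
  have -> : \sum_e c e ^+ 2 = kappa%:R ^+ 2 / B%:R ^+ 4 * (sqn u * sqn v).
    rewrite !sqn_col mulr_suml mulr_sumr.
    under [RHS]eq_bigr do rewrite !mulr_sumr.
    rewrite [RHS]pair_big /=; apply: eq_bigr => -[i j] _.
    by rewrite /c /=; field; rewrite gt_eqF.
  have un : sqn u <= B%:R ^+ 2 by rewrite sqn_lattice -natrX ler_nat.
  have vn : sqn v <= B%:R ^+ 2 by rewrite sqn_lattice -natrX ler_nat.
  have uv : sqn u * sqn v <= B%:R ^+ 4.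
    by rewrite (exprD _ 2 2) ler_pM ?sqn_ge0.
  rewrite -mulrA /k natrX ler_piMr ?sqr_ge0 //.
  by rewrite ler_pdivrMl ?exprn_gt0 // mulr1.
have ex : expR (2 * \sum_e c e ^+ 2) <= expR 2 ^+ k.
  by rewrite -expRM_natl ler_expR mulrC ler_wpM2r.
apply: (@le_trans _ _ (kappa%:R ^- (2 * k) *
    (2 * (2 * k)%:R ^+ (2 * k) * expR (2 * \sum_e c e ^+ 2)))).
  by rewrite ler_wpM2l ?invr_ge0 ?exprn_ge0 ?ler0n // Ebern_third_pow.
apply: (@le_trans _ _ (kappa%:R ^- (2 * k) * (2 * (2 * k)%:R ^+ (2 * k) * expR 2 ^+ k))).
  by rewrite ler_wpM2l ?invr_ge0 ?exprn_ge0 ?ler0n // ler_wpM2l // mulr_ge0 ?exprn_ge0 ?ler0n.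
rewrite le_eqVlt; apply/orP; left; apply/eqP.
have -> : (2 * k)%:R ^+ (2 * k) = (4 * k%:R) ^+ k * kappa%:R ^+ (2 * k) :> R.
  rewrite [LHS]exprM [kappa%:R ^+ _]exprM -exprMn; congr (_ ^+ _).
  by rewrite /k natrM natrX; ring.
rewrite [RHS](_ : _ = 2 * ((4 * k%:R) ^+ k * expR 2 ^+ k)); last by rewrite -exprMn.
move: ((4 * k%:R) ^+ k) (expR 2 ^+ k) => x y; field.
by rewrite expf_neq0 // gt_eqF.
Qed.

(* The constant is dominated by the squared cardinality of the net, [2 ^ (144 k)]. *)
Lemma dense_trace :
  Ebern (fun=> 3^-1) (fun b : {ffun 'I_r * 'I_r -> bool} =>
     \tr ((centered (fun=> 3^-1 : R) b *m (centered (fun=> 3^-1) b)^T) ^+ k)) <=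
  (2 ^+ 152 * expR 2 * k%:R) ^+ k.
Proof.
apply: le_trans (Ebern_le (third01 R (I := _)) trace_le_net) _.
rewrite EbernZ Ebern_sum.
have N0 : 0 <= r%:R * 4 ^+ k :> R by rewrite mulr_ge0 ?ler0n ?exprn_ge0.
apply: le_trans (ler_wpM2l N0 (ler_sum _ (fun zw nzw => form_moment nzw))) _.
rewrite sumr_const -[X in _ * X]mulr_natl.
have -> : #|net| = (#|[pred z : Z | in_net z]| * #|[pred z : Z | in_net z]|)%N.
  by rewrite -cardX; apply: eq_card => -[z w].
have hN := card_net_le R r B.
(* The exponent is 152 = 4 + 144 + 4: [16 ^ k] absorbs the prefactor [2 r = 8 k], the squared net
   has at most [2 ^ (144 k)] points, and two factors [4 ^ k] come from the net approximation and
   from the moment bound. *)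
have -> : (2 ^+ 152 * expR 2 * k%:R) ^+ k =
    16 ^+ k * (2 ^+ 148 * expR 2 * k%:R) ^+ k :> R.
  rewrite -exprMn; congr (_ ^+ _).
  have -> : 2 ^+ 152 = 2 ^+ 4 * 2 ^+ 148 :> R by rewrite -exprD.
  have -> : 2 ^+ 4 = 16 :> R by rewrite -natrX.
  move: (2 ^+ 148) => x; ring.
have hN2 : (#|[pred z : Z | in_net z]| * #|[pred z : Z | in_net z]|)%:R <=
    (2 ^+ 144) ^+ k :> R.
  have E : 2 ^+ (B ^ 2) * 4 ^+ r = (2 ^+ 72) ^+ k :> R.
    have -> : 4 = 2 ^+ 2 :> R by rewrite -natrX.
    rewrite -!exprM -exprD; congr (_ ^+ _).
    by rewrite /B /r /k expnMn; lia.
  have -> : 2 ^+ 144 = 2 ^+ 72 * 2 ^+ 72 :> R by rewrite -exprD.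
  by rewrite exprMn natrM -E; apply: ler_pM; rewrite ?ler0n.
have hk : (8 * k)%:R <= 16 ^+ k :> R.
  rewrite -natrX ler_nat.
  have : (k < 2 ^ k)%N by exact: ltn_expl.
  have : (8 <= 8 ^ k)%N by rewrite -[X in (X <= _)%N]expn1 leq_exp2l.
  rewrite -[16%N]/(8 * 2)%N expnMn; nia.
have hr : r%:R * 2 = (8 * k)%:R :> R by rewrite /r -/k -natrM; congr (_%:R); lia.
set N : R := (_ * _)%:R in hN2 *.
have -> : r%:R * 4 ^+ k * (N * (2 * (4 * k%:R * expR 2) ^+ k)) =
    (8 * k)%:R * (N * (4 * (4 * k%:R * expR 2)) ^+ k).
  rewrite -hr [(4 * (4 * k%:R * expR 2)) ^+ k]exprMn.
  move: (4 ^+ k) ((4 * k%:R * expR 2) ^+ k) => x y; ring.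
apply: ler_pM => //; rewrite ?mulr_ge0 ?exprn_ge0 ?mulr_ge0 ?expR_ge0 ?ler0n //.
apply: (@le_trans _ _ ((2 ^+ 144) ^+ k * (4 * (4 * k%:R * expR 2)) ^+ k)).
  by rewrite ler_wpM2r ?exprn_ge0 ?mulr_ge0 ?expR_ge0 ?ler0n.
rewrite -exprMn le_eqVlt; apply/orP; left; apply/eqP; congr (_ ^+ _).
have -> : 2 ^+ 148 = 2 ^+ 144 * 2 ^+ 4 :> R by rewrite -exprD.
have -> : 2 ^+ 4 = 16 :> R by rewrite -natrX.
move: (2 ^+ 144) => x; ring.
Qed.

End dense.

(** * Tail bounds *)

Section tails.
Variable R : realType.

(* [9] comes from the weight [3^-(2k)] of a walk in the dense model, [2^152 e^2] from
   [dense_trace]; the last [e^2] pays for the tail [exp (- 2 k)]. *)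
Definition norm_const : R := 9 * (2 ^+ 152 * expR 2) * expR 2.

Lemma norm_const_gt0 : 0 < norm_const.
Proof. by rewrite /norm_const !mulr_gt0 ?expR_gt0 ?exprn_gt0. Qed.

(** Here [k] is a power of 4 because it must be both a perfect square, for the lattice in
    [dense_trace], and a power of two, for [opb_of_trace]. *)
Lemma Ebern_norm_tail n (p : 'I_n * 'I_n -> R) q j :
  let k := ((2 ^ j.+1) ^ 2)%N in
  0 < q -> q <= 1 -> (forall e, 0 <= p e <= q) -> n%:R * q <= k%:R ->
  Ebern p (fun b => (~~ `[< opb (norm_const * k%:R) (centered p b) >])%:R) <=
  q^-1 * expR (- (2 * k%:R)).
Proof.
move=> k q0 q1 pq nqk.
have k0 : (0 < k)%N by rewrite !expn_gt0.
have k0' : 0 < k%:R :> R by rewrite ltr0n.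
have p01 e : 0 <= p e <= 1 by have /andP[-> /le_trans->] := pq e.
have c0 : 0 < norm_const * k%:R by rewrite mulr_gt0 ?norm_const_gt0.
have Ek : k = (2 ^ (j + j.+1).+1)%N by rewrite /k -expnM muln2 -addnn addSn.
(* Markov's inequality needs a nonnegative trace: [k] is even, so this is a squared Frobenius
   norm. *)
have tr0 b : 0 <= \tr ((centered p b *m (centered p b)^T) ^+ k).
  have -> : k = (2 * (2 ^ (j + j.+1)))%N by rewrite -expnS.
  rewrite exprM exprAC expr2.
  set S := (_ *m _) ^+ _.
  have SS : S^T = S by apply: trmx_exp; rewrite trmx_mul trmxK.
  rewrite -[X in \tr (_ * X)]SS -[_ * _]/(S *m S^T) -sqnE; exact: sqn_ge0.
apply: (@le_trans _ _ (Ebern p (fun b => \tr ((centered p b *m (centered p b)^T) ^+ k)) /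
    (norm_const * k%:R) ^+ k)).
  apply: (Ebern_markov p01 (Q := fun b => ~~ `[< opb (norm_const * k%:R) (centered p b) >])).
  - by rewrite exprn_gt0.
  - exact: tr0.
  - move=> b /asboolPn nop; rewrite leNgt; apply/negP => /ltW h.
    apply: nop; apply: (@opb_of_trace _ _ _ _ _ (j + j.+1)); first exact: ltW.
    by rewrite -Ek.
rewrite ler_pdivrMr ?exprn_gt0 // -(ler_pM2l q0) !mulrA divff ?gt_eqF // mul1r.
apply: le_trans (@trace_comparison R n (4 * (2 ^ j.+1) ^ 2) k p q k0 _ q1 nqk (ltW q0) pq) _.
  by rewrite -/k; lia.
have kap0 : (0 < 2 ^ j.+1)%N by rewrite expn_gt0.
apply: le_trans (ler_wpM2l _ (dense_trace R kap0)) _; first by rewrite exprn_ge0.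
rewrite -exprMn -/k.
have -> : expR (- (2 * k%:R)) = expR (- 2) ^+ k :> R by rewrite -expRM_natr mulNr.
rewrite -exprMn le_eqVlt; apply/orP; left; apply/eqP; congr (_ ^+ _).
rewrite /norm_const expRN; move: (2 ^+ 152) => x; field.
by rewrite gt_eqF ?expR_gt0.
Qed.

(** Chernoff with parameter 1: [1 - p + p / e <= 1 - p / 2 <= exp (- p / 2)], and half of the
    resulting exponent [u / 2] pays for the threshold [u / 4]. *)
Lemma Ebern_lower_tail (I : finType) (p : I -> R) (Q : pred I) :
  (forall i, 0 <= p i <= 1) ->
  Ebern p (fun b => (\sum_(i | Q i) (b i)%:R <= (\sum_(i | Q i) p i) / 4)%R%:R) <=
  expR (- ((\sum_(i | Q i) p i) / 4)).
Proof.
move=> p01; set u := \sum_(i | Q i) p i.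
pose f (b : {ffun I -> bool}) : R := expR (- \sum_(i | Q i) (b i)%:R).
apply: le_trans (@Ebern_markov _ _ p p01 _ f (expR (- (u / 4))) (expR_gt0 _) _ _) _.
- by move=> b; exact: expR_ge0.
- by move=> b h; rewrite /f ler_expR lerN2.
rewrite ler_pdivrMr ?expR_gt0 // -expRD.
have -> : Ebern p f = \prod_i (p i * (if Q i then expR (- 1) else 1) +
                               (1 - p i) * 1).
  rewrite -(Ebern_prod p (fun i v => if v then if Q i then expR (- 1) else 1 else 1)).
  apply: eq_bigr => b _; congr (_ * _).
  rewrite /f -sumrN expR_sum big_mkcond /=; apply: eq_bigr => i _.
  by case: (Q i); case: (b i); rewrite ?oppr0 ?expR0.
have -> : - (u / 4) - u / 4 = \sum_i (if Q i then - (p i / 2) else 0).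
  by rewrite -big_mkcond /= sumrN -mulr_suml -/u; field.
rewrite expR_sum; apply: ler_prod => i _.
have /andP[p0 p1] := p01 i.
have e1 : 0 < expR (- 1) :> R by exact: expR_gt0.
have e2 : expR (- 1) <= 2^-1 :> R.
  rewrite expRN lef_pV2 ?posrE ?expR_gt0 //.
  by have := @expR_ge1Dx R 1; lra.
case: (Q i); last by rewrite expR0; lra.
apply/andP; split; first by nra.
apply: (@le_trans _ _ (1 + - (p i / 2))); last exact: expR_ge1Dx.
nra.
Qed.

End tails.

(** * Deflation and eigenvalues *)

Section deflation.

(* Both sides are [\det (block_mx ('X - T) (- w) v 1)], multiplied by ['X - 1]. *)
Lemma char_poly_deflate (F : comNzRingType) n (T : 'M[F]_n) (w : 'cV_n) (v : 'rV_n) :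
  T *m w = w -> v *m w = 1%:M ->
  char_poly (T - w *m v) * ('X - 1) = char_poly T * 'X.
Proof.
move=> Tw vw; set P := char_poly_mx T.
pose w' := map_mx (@polyC F) w; pose v' := map_mx (@polyC F) v.
have Pw : P *m w' = ('X - 1) *: w'.
  rewrite /P /char_poly_mx mulmxBl mul_scalar_mx scalerBl scale1r; congr (_ - _).
  by rewrite -map_mxM Tw.
have vw' : v' *m w' = 1%:M by rewrite -map_mxM vw map_mx1.
have PB : char_poly_mx (T - w *m v) = P + w' *m v'.
  by rewrite /P /char_poly_mx map_mxB map_mxM opprB addrA addrAC.
pose N := block_mx P (- w') v' (1%:M : 'M[{poly F}]_1).
have d1 : \det N = char_poly (T - w *m v).
  rewrite /char_poly PB.
  have -> : N = block_mx (P + w' *m v') (- w') 0 1%:M *m block_mx 1%:M 0 v' 1%:M.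
    rewrite mulmx_block !mulmx1 !mul1mx ?mulmx0 ?mul0mx !add0r mulNmx.
    by rewrite addrK.
  by rewrite det_mulmx det_ublock det_lblock !det1 !mulr1.
have d2 : \det N * ('X - 1) = char_poly T * 'X.
  have : N *m block_mx 1%:M w' 0 ('X - 1)%:M = block_mx P 0 v' 'X%:M.
    rewrite mulmx_block !mulmx1 !mulmx0 !mul1mx !addr0 Pw vw' mul_mx_scalar.
    rewrite scalerN subrr; congr block_mx.
    by rewrite -raddfD /= addrC subrK.
  move/(congr1 (fun M => \det M)).
  by rewrite det_mulmx det_ublock det_lblock det1 mul1r !det_scalar1.
by rewrite -d1 d2.
Qed.

End deflation.

Section spectrum.
Variable R : realType.

Lemma cmod_sq (z : R[i]) : cmod z ^+ 2 = complex.Re z ^+ 2 + complex.Im z ^+ 2.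
Proof.
by case: z => a b; rewrite /cmod /= sqr_sqrtr // addr_ge0 ?sqr_ge0.
Qed.

Lemma cmod_ge0 (z : R[i]) : 0 <= cmod z.
Proof. by case: z => a b; exact: sqrtr_ge0. Qed.

(** The real bound is applied separately to the real and imaginary parts [a], [b] of a left
    eigenvector; multiplication by [z] scales [sqn a + sqn b] by exactly [cmod z ^ 2]. *)
Lemma eigenvalue_opb n (M : 'M[R]_n) c z : 0 <= c -> opb c M ->
  eigenvalue (complexify M) z -> cmod z ^+ 2 <= c.
Proof.
move=> c0 cM /eigenvalueP[f fM f0].
pose a : 'rV[R]_n := map_mx (@complex.Re R) f.
pose b : 'rV[R]_n := map_mx (@complex.Im R) f.
have ab0 : 0 < sqn a + sqn b.
  rewrite lt_def addr_ge0 ?sqn_ge0 // andbT; apply: contra_neq f0 => ab.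
  have a0 : a = 0.
    by apply: sqn_eq0; have := sqn_ge0 a; have := sqn_ge0 b; lra.
  have b0 : b = 0.
    by apply: sqn_eq0; have := sqn_ge0 a; have := sqn_ge0 b; lra.
  apply/matrixP => i j; move/matrixP/(_ i j): a0; move/matrixP/(_ i j): b0.
  by rewrite !mxE; case: (f i j) => x y /= -> ->.
have ReM : a *m M = map_mx (@complex.Re R) (z *: f).
  rewrite -fM; apply/matrixP => i j; rewrite !mxE raddf_sum /=.
  apply: eq_bigr => l _; rewrite !mxE.
  by case: (f i l) => x y /=; rewrite mulr0 subr0.
have ImM : b *m M = map_mx (@complex.Im R) (z *: f).
  rewrite -fM; apply/matrixP => i j; rewrite !mxE raddf_sum /=.
  apply: eq_bigr => l _; rewrite !mxE.
  by case: (f i l) => x y /=; rewrite mulr0 add0r mulrC.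
have E : sqn (a *m M) + sqn (b *m M) = cmod z ^+ 2 * (sqn a + sqn b).
  rewrite ReM ImM /sqn !big_ord1 -!big_split mulr_sumr /=; apply: eq_bigr => i _.
  rewrite !mxE cmod_sq; case: (f 0 i) => x y; case: z {fM ReM ImM} => s t /=; ring.
have rowle (v : 'rV[R]_n) : sqn (v *m M) <= c * sqn v.
  by rewrite -sqn_tr trmx_mul -(sqn_tr v); apply: opb_tr.
rewrite -(ler_pM2r ab0) -E mulrDr; exact: lerD.
Qed.

(** As multisets, the spectrum of [T] with 0 added is the spectrum of the deflated matrix with 1
    added. Hence at most one eigenvalue of [T] exceeds [e] in modulus, and the ordering puts it
    first. *)
Lemma max_nontrivial_modulus_le n (T : 'M[R]_n) (w : 'cV_n) (v : 'rV_n) e :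
  0 <= e -> T *m w = w -> v *m w = 1%:M -> opb (e ^+ 2) (T - w *m v) ->
  max_nontrivial_modulus (complexify T) <= e.
Proof.
move=> e0 Tw vw op.
set TC := complexify T; set BC := complexify (T - w *m v).
have chB : char_poly BC * ('X - 1) = char_poly TC * 'X.
  have -> : BC = TC - map_mx (real_complex R) w *m map_mx (real_complex R) v.
    by rewrite /BC /complexify map_mxB map_mxM.
  by apply: char_poly_deflate; rewrite -map_mxM ?Tw // vw map_mx1.
rewrite /max_nontrivial_modulus /lambda /eigenvalues.
case: (closed_field_poly_normal _) => rs /= Ers.
case: (closed_field_poly_normal (char_poly BC)) => rsB /= ErsB.
rewrite (monicP (char_poly_monic _)) scale1r in Ers.
rewrite (monicP (char_poly_monic _)) scale1r in ErsB.
have permT : perm_eq (0 :: rs) (1 :: rsB).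
  apply: prod_XsubC_eq; rewrite !big_cons -Ers -ErsB subr0 mulrC -chB mulrC.
  by rewrite polyC1.
have smallB z : z \in rsB -> cmod z <= e.
  move=> zB; rewrite -(@ler_pXn2r _ 2) ?nnegrE ?cmod_ge0 //.
  apply: eigenvalue_opb op _; first exact: sqr_ge0.
  by rewrite eigenvalue_root_char -/BC ErsB root_prod_XsubC.
pose big z := e < cmod z.
have cnt : (count big rs <= 1)%N.
  have /permP/(_ big) := permT.
  rewrite /= => E; apply: leq_trans (leq_addl (big 0) _) _; rewrite E.
  have -> : count big rsB = 0%N.
    by apply/eqP; rewrite -leqn0 leqNgt -has_count; apply/hasPn => z /smallB; rewrite /big -leNgt.
  by rewrite addn0 leq_b1.
set s := sort _ rs.
have total_s : total (fun z w : R[i] => cmod w <= cmod z) by move=> x y; exact: le_total.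
have trans_s : transitive (fun z w : R[i] => cmod w <= cmod z).
  by move=> y x z xy yz; exact: le_trans yz xy.
have sorted_s : sorted (fun z w => cmod w <= cmod z) s by exact: sort_sorted.
have cnts : (count big s <= 1)%N by rewrite (permP (permEl (perm_sort _ _))).
rewrite big_nat_cond; elim/big_rec: _ => // j x /andP[/andP[j2 _] _] xe.
rewrite ge_max xe andbT leNgt; apply/negP => bigj.
case: s sorted_s cnts bigj => [|z0 s].
  by rewrite nth_nil /cmod /= !expr0n addr0 sqrtr0 ltNge e0.
case: j j2 => [|[|j]] // _ /= ps cnts bigj.
(* An index past the end reads the default 0, whose modulus cannot exceed [e]. *)
have js : (j < size s)%N.
  rewrite ltnNge; apply/negP => sj; move: bigj.
  by rewrite nth_default // /cmod /= !expr0n addr0 sqrtr0 ltNge e0.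
have zj : cmod (nth 0 s j) <= cmod z0.
  have := order_path_min trans_s ps => /allP; apply; exact: mem_nth.
have h0 : big z0 by exact: lt_le_trans bigj zj.
have : (0 < count big s)%N.
  by rewrite -has_count; apply/hasP; exists (nth 0 s j) => //; exact: mem_nth.
by move: cnts; rewrite h0; lia.
Qed.

Lemma transition_matrix_gap n (A M : 'M[R]_n) (u : 'cV_n) (v : 'rV_n) d c h :
  0 < d -> 0 <= c -> (forall x, d <= out_degree A x) -> A = u *m v + M ->
  v *m const_mx 1 = 1%:M -> n%:R * sqn v <= h -> opb c M ->
  max_nontrivial_modulus (complexify (transition_matrix A)) <=
  Num.sqrt (c * (2 * (1 + h))) / d.
Proof.
move=> d0 c0 dA AE v1 vh cM; pose one : 'cV[R]_n := const_mx 1.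
set T := transition_matrix A; set D := inv_degree_matrix A.
(* All degrees are positive, so the default value in [inv_degree_matrix] never occurs. *)
have deg0 x : 0 < out_degree A x by exact: lt_le_trans (dA x).
have h0 : 0 <= h by apply: le_trans vh; rewrite mulr_ge0 ?sqn_ge0 ?ler0n.
have T1 : T *m one = one.
  apply/matrixP => x y; rewrite /T /transition_matrix -mulmxA mul_diag_mx !mxE deg0.
  rewrite (_ : \sum_j _ = out_degree A x) ?mulVf ?gt_eqF //.
  by apply: eq_bigr => j _; rewrite mxE mulr1.
have TB : T - one *m v = D *m (M *m (1%:M - one *m v)).
  have -> : M = A - u *m v by rewrite AE addrC addKr.
  (* The projection [1 - 1 v] annihilates [u v] from the right since [v 1 = 1], so [A] and [M] agree
     after multiplication by it. *)
  have E : (A - u *m v) *m (1%:M - one *m v) = A - A *m one *m v.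
    rewrite mulmxBl !mulmxBr !mulmx1 !mulmxA -[u *m v *m one]mulmxA v1 mulmx1.
    by rewrite subrr subr0.
  by rewrite E mulmxBr !mulmxA -[D *m A]/T T1.
have opD : opb (d ^- 2) D.
  move=> w; rewrite !sqn_col mulr_sumr; apply: ler_sum => i _.
  rewrite /D /inv_degree_matrix mul_diag_mx !mxE deg0 exprMn ler_wpM2r ?sqr_ge0 //.
  rewrite exprVn lef_pV2 ?posrE ?exprn_gt0 //.
  by rewrite lerXn2r ?nnegrE ?(ltW d0) ?(ltW (deg0 _)) ?dA.
have opP : opb (2 * (1 + h)) (1%:M - one *m v).
  move=> w; rewrite mulmxBl mul1mx; apply: le_trans (sqnD_le _ _) _.
  rewrite -[- (one *m v *m w)]scaleN1r sqnZ sqrrN expr1n mul1r.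
  rewrite -mulrA ler_wpM2l // mulrDl mul1r lerD2l -mulmxA.
  apply: le_trans (sqn_mul _ _) _.
  have -> : sqn one = n%:R.
    by rewrite sqn_col (eq_bigr (fun=> 1)) ?sumr_const ?card_ord // => i _; rewrite mxE expr1n.
  apply: le_trans (ler_wpM2l _ (sqn_mul _ _)) _; first exact: ler0n.
  by rewrite mulrA ler_wpM2r ?sqn_ge0.
apply: (max_nontrivial_modulus_le (w := one) (v := v)) => //.
  by rewrite divr_ge0 ?sqrtr_ge0 ?ltW.
rewrite TB exprMn sqr_sqrtr; last by rewrite !mulr_ge0 ?addr_ge0.
rewrite exprVn mulrC; apply: opb_mul => //; first by rewrite invr_ge0 exprn_ge0 ?ltW.
exact: opb_mul.
Qed.

End spectrum.

(** * The directed Chung--Lu law *)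

Local Open Scope classical_set_scope.
Local Open Scope ring_scope.

Section law.
Context d (T : measurableType d) (R : realType) (P : probability T R).

Definition link_prob n (wp wm : 'I_n -> R) (s : R) (e : 'I_n * 'I_n) : R :=
  s * wp e.1 * wm e.2 / \sum_z wp z.

(** The event is a finite disjoint union of atoms, each an intersection over all pairs, whose
    probability independence turns into [bmass]. *)
Lemma chung_lu_law n (wp wm : 'I_n -> R) (s : R) (a : 'I_n * 'I_n -> {mfun T >-> bool})
    (Q : pred {ffun 'I_n * 'I_n -> bool}) :
  directed_chung_lu P wp wm s a ->
  P [set omega | Q [ffun e => a e omega]] =
  (Ebern (link_prob wp wm s) (fun b => (Q b)%:R))%:E.
Proof.
move=> [indep marg].
have ma e (v : bool) : measurable (a e @^-1` [set v]).
  by rewrite -[X in measurable X]setTI; exact: measurable_funP.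
have marg_v e v : P (a e @^-1` [set v]) =
    (if v then link_prob wp wm s e else 1 - link_prob wp wm s e)%:E.
  have h : P (a e @^-1` [set true]) = (link_prob wp wm s e)%:E.
    by rewrite [X in a X @^-1` _]surjective_pairing marg.
  case: v => //.
  have -> : a e @^-1` [set false] = ~` (a e @^-1` [set true]).
    by apply/seteqP; split => x /=; case: (a e x).
  by rewrite probability_setC // h.
pose C (b : {ffun 'I_n * 'I_n -> bool}) : set T := [set omega | [ffun e => a e omega] = b].
have CE b : C b = \bigcap_(e in [set` [set: 'I_n * 'I_n]%SET]) (a e @^-1` [set b e]).
  apply/seteqP; split => [x /= <- e _ /=|x /= H]; first by rewrite ffunE.
  by apply/ffunP => e; rewrite ffunE; apply: H => /=; rewrite inE.
have PC b : P (C b) = (bmass (link_prob wp wm s) b)%:E.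
  rewrite CE indep // /bmass.
  rewrite -[RHS]prodEFin.
  apply: eq_big => [e|e _]; first by rewrite inE.
  exact: marg_v.
have mC b : measurable (C b).
  rewrite CE; apply: fin_bigcap_measurable => // e _; exact: ma.
have -> : [set omega | Q [ffun e => a e omega]] = \bigcup_(b in [set` Q]) C b.
  apply/seteqP; split => [x /= Qx|x [b /= Qb]]; first by exists [ffun e => a e x].
  by rewrite /C /= => ->.
rewrite measure_fin_bigcup //; last by move=> b b' _ _ [x []]; rewrite /C /= => <- <-.
rewrite (fsbigE (enum Q)) ?enum_uniq //=; last first.
- by move=> b Qb; rewrite mem_enum; case/negP.
- by move=> b /=; rewrite mem_enum.
rewrite big_enum_cond /Ebern -sumEFin big_mkcond /=; apply: eq_bigr => b _.
rewrite PC mem_setE andbb unfold_in; case: (Q b); rewrite ?mulr1 ?mulr0 //.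
Qed.

End law.

(** * Explicit bound at fixed size *)

Section finite_size.
Variable R : realType.

Lemma sum_row n (F : 'I_n * 'I_n -> R) x : \sum_(i | i.1 == x) F i = \sum_y F (x, y).
Proof.
rewrite (reindex_onto (fun y => (x, y)) snd) => [|[i j] /= /eqP -> //].
by apply: eq_bigl => y; rewrite /= !eqxx.
Qed.

Lemma pow4_approx (t : R) : 1 <= t ->
  exists j, t <= ((2 ^ j.+1) ^ 2)%:R /\ ((2 ^ j.+1) ^ 2)%:R <= 4 * t.
Proof.
move=> t1; have N0 : (0 < Num.truncn t)%N by rewrite truncn_gt0.
have /andP[le1 lt2] := trunc_log_bounds (isT : (1 < 4)%N) N0.
exists (trunc_log 4 (Num.truncn t)); move: le1 lt2.
set j := trunc_log _ _; have -> : ((2 ^ j.+1) ^ 2 = 4 ^ j.+1)%N by rewrite expnAC.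
move=> le1 lt2; split.
  by apply/ltW/(lt_le_trans (truncnS_gt t)); rewrite ler_nat.
rewrite expnS natrM ler_wpM2l // (le_trans (_ : _ <= (Num.truncn t)%:R)) ?ler_nat //.
by rewrite truncn_le (le_trans _ t1).
Qed.

(** The factors are [norm_const * k] with [k <= 4 (C ^ 2 / c) s], the squared norm bound [2 (1 + h)]
    of the projection with [h = C ^ 2 / c ^ 2], and the degree bound [s c / 4]. The final 1 makes
    the inequality strict. *)
Definition gap_const (c C : R) : R :=
  Num.sqrt (norm_const R * (4 * (C ^+ 2 / c)) * (2 * (1 + C ^+ 2 / c ^+ 2))) * (4 / c) + 1.

Lemma Ebern_gap n (wp wm : 'I_n -> R) (s c C : R) :
  (0 < n)%N -> 0 < s -> 0 < c -> c < C ->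
  (forall x, c <= wp x <= C /\ c <= wm x <= C) ->
  \sum_x wp x = \sum_x wm x ->
  1 <= C ^+ 2 / c * s -> C ^+ 2 / c * s <= n%:R ->
  Ebern (link_prob wp wm s) (fun b =>
    (gap_const c C / Num.sqrt s <= max_nontrivial_modulus
      (complexify (transition_matrix (adjacency_matrix R b))))%R%:R) <=
  n%:R * expR (- (2 * (C ^+ 2 / c * s))) + n%:R * expR (- (s * c / 4)).
Proof.
move=> n0 s0 c0 cC wcC bal.
set C0 := C ^+ 2 / c; set p := link_prob wp wm s => C1 Cn.
have C_gt0 : 0 < C by exact: lt_trans cC.
have C00 : 0 < C0 by rewrite divr_gt0 ?exprn_gt0.
have n0' : 0 < n%:R :> R by rewrite ltr0n.
have wp0 x : 0 < wp x by have [/andP[/(lt_le_trans c0)]] := wcC x.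
have wm0 x : 0 < wm x by have [_ /andP[/(lt_le_trans c0)]] := wcC x.
set W := \sum_x wp x.
have Wge : c * n%:R <= W.
  have -> : c * n%:R = \sum_(x < n) c by rewrite sumr_const card_ord mulr_natr.
  by apply: ler_sum => x _; have [/andP[]] := wcC x.
have W0 : 0 < W by apply: lt_le_trans Wge; rewrite mulr_gt0.
pose q := C0 * s / n%:R.
have q0 : 0 < q by rewrite /q divr_gt0 // mulr_gt0.
have q1 : q <= 1 by rewrite /q ler_pdivrMr // mul1r.
have pq e : 0 <= p e <= q.
  apply/andP; split.
    by rewrite /p /link_prob divr_ge0 ?mulr_ge0 ?ltW.
  rewrite /p /link_prob -/W ler_pdivrMr //.
  have [/andP[_ h1] _] := wcC e.1; have [_ /andP[_ h2]] := wcC e.2.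
  apply: (@le_trans _ _ (s * (C * C))).
    by rewrite -mulrA ler_wpM2l ?(ltW s0) // ler_pM ?(ltW (wp0 _)) ?(ltW (wm0 _)).
  apply: (@le_trans _ _ (q * (c * n%:R))); last by rewrite ler_wpM2l // (ltW q0).
  rewrite le_eqVlt; apply/orP; left; apply/eqP.
  by rewrite /q /C0; field; rewrite !gt_eqF.
have p01 e : 0 <= p e <= 1 by have /andP[-> /le_trans->] := pq e.
have [j] := pow4_approx C1; set k := ((2 ^ j.+1) ^ 2)%N => -[kge kle].
have nqk : n%:R * q <= k%:R by rewrite /q mulrC divfK ?gt_eqF.
pose bad_row x (b : {ffun 'I_n * 'I_n -> bool}) : bool :=
  \sum_(i | i.1 == x) (b i)%:R <= (\sum_(i | i.1 == x) p i) / 4.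
pose bad_norm (b : {ffun 'I_n * 'I_n -> bool}) : bool :=
  ~~ `[< opb (norm_const R * k%:R) (centered p b) >].
have rowp x : \sum_(i | i.1 == x) p i = s * wp x.
  rewrite sum_row /p /link_prob /= -/W.
  rewrite -mulr_suml -mulr_sumr -bal -/W -mulrA divff ?mulr1 // gt_eqF //.
have det (b : {ffun 'I_n * 'I_n -> bool}) : (gap_const c C / Num.sqrt s <= max_nontrivial_modulus
      (complexify (transition_matrix (adjacency_matrix R b))))%R%:R <=
    (bad_norm b)%:R + \sum_x (bad_row x b)%:R :> R.
  have S0 : 0 <= \sum_x (bad_row x b)%:R :> R by apply: sumr_ge0 => x _; exact: ler0n.
  have [bn|] := boolP (bad_norm b).
    by apply: (@le_trans _ _ 1); rewrite ?lern1 ?leq_b1 // lerDl.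
  rewrite negbK => /asboolP op; rewrite add0r.
  have [/existsP[x bx]|/existsPn good] := boolP [exists x, bad_row x b].
    rewrite (bigD1 x) //= bx; apply: (@le_trans _ _ 1); rewrite ?lern1 ?leq_b1 // lerDl.
    by apply: sumr_ge0 => y _; exact: ler0n.
  suff : max_nontrivial_modulus (complexify (transition_matrix (adjacency_matrix R b))) <
      gap_const c C / Num.sqrt s by rewrite ltNge => /negbTE ->.
  pose u : 'cV[R]_n := \col_x (s * wp x); pose v : 'rV[R]_n := \row_y (wm y / W).
  have h1 : v *m const_mx 1 = 1%:M.
    apply/matrixP => i l; rewrite !ord1 !mxE eqxx mulr1n.
    under eq_bigr do rewrite !mxE mulr1.
    by rewrite -mulr_suml -bal divff // gt_eqF.
  have h2 : n%:R * sqn v <= C ^+ 2 / c ^+ 2.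
    have h : sqn v <= n%:R * (C / (c * n%:R)) ^+ 2.
      rewrite /sqn big_ord1 mulr_natl -[X in _ <= X *+ _]mulr1.
      have -> : (C / (c * n%:R)) ^+ 2 * 1 *+ n = \sum_(y < n) (C / (c * n%:R)) ^+ 2.
        by rewrite sumr_const card_ord mulr1.
      apply: ler_sum => y _; rewrite mxE.
      have [_ /andP[_ hy]] := wcC y.
      rewrite lerXn2r ?nnegrE ?divr_ge0 ?mulr_ge0 ?(ltW (wm0 _)) ?(ltW W0) ?(ltW C_gt0) ?(ltW c0) //.
      by rewrite ler_pM ?invr_ge0 ?(ltW (wm0 _)) ?(ltW W0) // lef_pV2 ?posrE ?mulr_gt0.
    apply: le_trans (ler_wpM2l (ltW n0') h) _.
    rewrite le_eqVlt; apply/orP; left; apply/eqP.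
    by field; rewrite !gt_eqF.
  have h3 : adjacency_matrix R b = u *m v + centered p b.
    apply/matrixP => x y; rewrite !mxE big_ord1 !mxE /p /link_prob /= -/W.
    by rewrite addrC mulrA subrK.
  have sc0 : 0 < s * c / 4 by rewrite divr_gt0 ?mulr_gt0.
  have h4 x : s * c / 4 <= out_degree (adjacency_matrix R b) x.
    have := good x; rewrite /bad_row -ltNge rowp sum_row => h.
    have -> : out_degree (adjacency_matrix R b) x = \sum_y (b (x, y))%:R.
      by apply: eq_bigr => y _; rewrite mxE.
    apply/ltW/(le_lt_trans _ h); rewrite ler_pM2r ?invr_gt0 // ler_pM2l //.
    by have [/andP[]] := wcC x.
  have nk0 : 0 <= norm_const R * k%:R.
    by rewrite mulr_ge0 ?ler0n // ltW // norm_const_gt0.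
  apply: le_lt_trans (transition_matrix_gap sc0 nk0 h4 h3 h1 h2 op) _.
  have ss0 : 0 < Num.sqrt s by rewrite sqrtr_gt0.
  have ssE : s = Num.sqrt s ^+ 2 by rewrite sqr_sqrtr // ltW.
  rewrite ltr_pdivlMr //.
  set h := 2 * (1 + C ^+ 2 / c ^+ 2).
  have h0 : 0 <= h by rewrite mulr_ge0 ?addr_ge0 ?divr_ge0 ?exprn_ge0 ?ltW.
  have sqle : Num.sqrt (norm_const R * k%:R * h) <=
      Num.sqrt (norm_const R * (4 * C0) * h) * Num.sqrt s.
    rewrite -sqrtrM; last first.
      by rewrite mulr_ge0 // mulr_ge0 ?(ltW (norm_const_gt0 _)) // mulr_ge0 ?(ltW C00).
    rewrite ler_wsqrtr //.
    have -> : norm_const R * (4 * C0) * h * s = norm_const R * (4 * (C0 * s)) * h by ring.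
    by rewrite ler_wpM2r // ler_wpM2l // ltW // norm_const_gt0.
  rewrite /gap_const -/C0 -/h; set X := Num.sqrt (_ * h) in sqle *.
  set Y := Num.sqrt (_ * h) in sqle *.
  apply: (@le_lt_trans _ _ (Y * (4 / c))); last by rewrite ltrDl.
  have -> : Y * (4 / c) = Y * Num.sqrt s / (s * c / 4) * Num.sqrt s.
    by rewrite [X in _ / (X * c / 4)]ssE; field; rewrite !gt_eqF.
  by rewrite ler_wpM2r ?(ltW ss0) // ler_wpM2r // invr_ge0 ltW.
apply: le_trans (Ebern_le p01 det) _.
rewrite EbernD Ebern_sum; apply: lerD.
  (* The factor [q^-1] equals [n / ((C ^ 2 / c) s)], at most [n] because the denominator is at least
     1. *)
  apply: le_trans (@Ebern_norm_tail R n p q j q0 q1 pq nqk) _.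
  rewrite ler_pM ?invr_ge0 ?expR_ge0 ?(ltW q0) //.
    by rewrite /q invf_div ler_pdivrMr; [rewrite ler_peMr // ltW | rewrite mulr_gt0].
  by rewrite ler_expR lerN2 ler_wpM2l.
apply: (@le_trans _ _ (\sum_(x < n) expR (- (s * c / 4)))); last first.
  by rewrite sumr_const card_ord mulr_natl.
apply: ler_sum => x _.
apply: le_trans (@Ebern_lower_tail R _ p (fun i => i.1 == x) p01) _.
rewrite ler_expR lerN2 rowp ler_pM2r ?invr_gt0 // ler_pM2l //.
by have [/andP[]] := wcC x.
Qed.

End finite_size.

(** Since [L + 1 + L ^ 2 <= 3 L ^ 2], each term is at most [exp (- 1) <= 1 / 2] times the target. *)
Lemma superpolynomial_tail (R : realType) (n L x y : R) : n = expR L -> 1 <= L ->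
  3 * L ^+ 2 <= x -> 3 * L ^+ 2 <= y ->
  n * expR (- x) + n * expR (- y) <= expR (- (L ^+ 2)).
Proof.
move=> -> L1.
have H z : 3 * L ^+ 2 <= z -> expR L * expR (- z) <= expR (- 1) * expR (- (L ^+ 2)).
  move=> hz; rewrite -!expRD ler_expR.
  have : 1 <= L ^+ 2 by rewrite expr_ge1 //; lra.
  have : L <= L ^+ 2 by rewrite expr2 ler_peMr //; lra.
  lra.
move=> /H hx /H hy.
have e1 : expR (- 1) <= 2^-1 :> R.
  rewrite expRN lef_pV2 ?posrE ?expR_gt0 //.
  by have := @expR_ge1Dx R 1; lra.
have e2 : 0 < expR (- (L ^+ 2)) by exact: expR_gt0.
have : expR (- 1) * expR (- (L ^+ 2)) <= 2^-1 * expR (- (L ^+ 2)).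
  by rewrite ler_wpM2r // ltW.
lra.
Qed.

Theorem theorem2p12 (R : realType)
  (wp wm : forall n, 'I_n -> R) (s : nat -> R)
  (d : nat -> measure_display) (T : forall n, measurableType (d n))
  (P : forall n, probability (T n) R)
  (a : forall n, 'I_n * 'I_n -> {mfun T n >-> bool})
  (wp_ge0 : forall n (x : 'I_n), 0 <= wp n x)
  (wm_ge0 : forall n (x : 'I_n), 0 <= wm n x)
  (w_balanced : forall n, \sum_(x < n) wp n x = \sum_(x < n) wm n x)
  (s_gt0 : forall n, 0 < s n)
  (model : \forall n \near \oo,
     directed_chung_lu (P n) (wp n) (wm n) (s n) (a n))
  (hW : weight_profile wp wm)
  (hX : sparsity_growth s) :
  exists K eta : R, [/\ 0 < K, 1 < eta &
    \forall n \near \oo,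
      (P n [set omega : T n |
              (K / Num.sqrt (s n) <=
               max_nontrivial_modulus
                 (complexify (transition_matrix
                    (adjacency_matrix R (fun xy => a n xy omega)))))%R]
       <= (expR (- (ln n%:R `^ eta)))%:E)%E].
Proof.
case: hW => -[c [C [c0 cC wcC]]] _.
case: hX => xi [xi4 lns sn].
(* The exponent 2 works because s dominates [L ^ xi], hence [L ^ 2], for [L = ln n]. *)
exists (gap_const c C), 2; split.
- by rewrite /gap_const ltr_pwDr // mulr_ge0 ?sqrtr_ge0 // divr_ge0 // ltW.
- by lra.
have C0 : 0 < C by exact: lt_trans cC.
have cle : c <= C ^+ 2 / c by rewrite ler_pdivlMr // -expr2 lerXn2r ?nnegrE ?ltW.
have CC0 : 0 < C ^+ 2 / c by rewrite divr_gt0 ?exprn_gt0.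
(* The value [c / 12] is a third of [c / 4]: it yields [3 L ^ 2 <= s c / 4], as
   [superpolynomial_tail] requires. *)
have near_s : \forall n \near \oo, ln n%:R `^ xi / s n < c / 12.
  by apply: (cvgr_lt _ lns); rewrite divr_gt0.
have near_n : \forall n \near \oo, s n / n%:R < (C ^+ 2 / c)^-1.
  by apply: (cvgr_lt _ sn); rewrite invr_gt0.
have near_e : \forall n \near \oo, expR 1 <= n%:R :> R by exact: nbhs_infty_ger.
apply: filterS (filterI (filterI model near_s) (filterI near_n near_e)).
move=> n [[mod lsn] [snn ne]]; have sn0 := s_gt0 n.
have n0' : 0 < n%:R :> R by apply: lt_le_trans ne; exact: expR_gt0.
have n0 : (0 < n)%N by rewrite -(ltr0n R).
pose L : R := ln n%:R.
have nL : n%:R = expR L by rewrite lnK // posrE.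
have L1 : 1 <= L by rewrite -ler_expR -nL.
have L0 : 0 <= L by lra.
have Ls : L `^ xi < c / 12 * s n.
  by rewrite -ltr_pdivrMr.
have L2 : L ^+ 2 <= L `^ xi.
  by rewrite -powR_mulrn // ler_powR //; lra.
have L21 : 1 <= L ^+ 2 by rewrite expr_ge1.
have s1 : C ^+ 2 / c * s n <= n%:R.
  by rewrite mulrC -ler_pdivlMr // mulrC -ler_pdivrMr // ltW.
have cs : c * s n <= C ^+ 2 / c * s n by rewrite ler_wpM2r // ltW.
have s2 : 1 <= C ^+ 2 / c * s n by lra.
pose Q (b : {ffun 'I_n * 'I_n -> bool}) := (gap_const c C / Num.sqrt (s n) <=
  max_nontrivial_modulus (complexify (transition_matrix (adjacency_matrix R b))))%R.
have -> : [set omega : T n | (gap_const c C / Num.sqrt (s n) <=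
    max_nontrivial_modulus (complexify (transition_matrix
      (adjacency_matrix R (fun xy => a n xy omega)))))%R] =
    [set omega | Q [ffun e => a n e omega]].
  apply/seteqP; split => omega /=; rewrite /Q;
    have -> // : adjacency_matrix R [ffun e => a n e omega] =
      adjacency_matrix R (fun xy => a n xy omega);
    by apply/matrixP => x y; rewrite !mxE ffunE.
rewrite (@chung_lu_law _ _ _ _ n (wp n) (wm n) (s n))//.
rewrite lee_fin powR_mulrn // -/L.
apply: le_trans (Ebern_gap n0 sn0 c0 cC (wcC n) (w_balanced n) s2 s1) _.
by apply: superpolynomial_tail => //; lra.
Qed.
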